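(* Let $(a_1,\dots,a_d)$ and $(b_1,\dots,b_d)$ be $d$-tuples of permutations in $S_n$ such that, for some $j\in[d]$, the permutations $a_j$ and $b_j$ are $n$-cycles. Then one can test whether there exists $\tau\in S_n$ with $b_k=\tau^{-1}a_k\tau$ for all $k=1,\dots,d$ in $O(dn)$ time and $O(dn)$ space.
   Context: $[n]=\{1,\dots,n\}$. Permutations are multiplied from left to right. The model of computation is a $b$-bit RAM, with $n,d=O(2^b)$. *)

(* Defs.v *)
From mathcomp Require Export all_boot all_fingroup.

Set Implicit Arguments.
Unset Strict Implicit.
Unset Printing Implicit Defensive.

(** * The [w]-bit RAM

    Registers and memory cells hold [w]-bit words, represented as naturals
    below [2 ^ w]: the initial state contains only words and every instruction
    reduces what it computes modulo [2 ^ w].  Each instruction costs one unit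
    of time.  A program does not depend on [w]; jump targets are part of the
    program text and are not words.

    Since [n] and [d] may both be of order [2 ^ w], an array of [d * n] entries
    has indices of about [2 * w] bits.  A memory address is therefore given by
    a list of registers, least significant word first, whose length is fixed in
    the program text. *)

Definition reg := nat.

Inductive binop := Add | Sub | Mul | Div | Mod.

Inductive instr :=
  | Const of reg & nat
  | Arith of binop & reg & reg & reg       (* destination first *)
  | Read of reg & seq reg
  | Write of seq reg & reg
  | Jump of nat
  | JumpEq of reg & reg & nat
  | JumpLt of reg & reg & nat
  | Halt of bool.

Definition program := seq instr.

Record state := State {
  pc : nat;
  regs : reg -> nat;
  mem : nat -> nat
}.

(* On words; [Sub] wraps around, division by zero yields 0, and [Mod] by zero
   returns its first argument. *)
Definition eval_binop (w : nat) (o : binop) (x y : nat) : nat :=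
  match o with
  | Add => (x + y) %% 2 ^ w
  | Sub => (x + (2 ^ w - y)) %% 2 ^ w
  | Mul => (x * y) %% 2 ^ w
  | Div => x %/ y
  | Mod => x %% y
  end.

Definition address (w : nat) (f : reg -> nat) (rs : seq reg) : nat :=
  foldr (fun r acc => f r + 2 ^ w * acc) 0 rs.

Definition fetch (P : program) (s : state) : option instr := onth P (pc s).

(* [Halt] and a program counter outside the program leave the state unchanged,
   but only [Halt] counts as termination below. *)
Definition step (w : nat) (P : program) (s : state) : state :=
  let: State i f m := s in
  match fetch P s with
  | Some (Const r v) => State i.+1 [eta f with r |-> v %% 2 ^ w] m
  | Some (Arith o r x y) =>
      State i.+1 [eta f with r |-> eval_binop w o (f x) (f y)] m
  | Some (Read r rs) => State i.+1 [eta f with r |-> m (address w f rs)] m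
  | Some (Write rs r) => State i.+1 f [eta m with address w f rs |-> f r]
  | Some (Jump l) => State l f m
  | Some (JumpEq x y l) => State (if f x == f y then l else i.+1) f m
  | Some (JumpLt x y l) => State (if f x < f y then l else i.+1) f m
  | Some (Halt _) | None => s
  end.

Definition access_below (w : nat) (P : program) (S : nat) (s : state) : bool :=
  match fetch P s with
  | Some (Read _ rs) | Some (Write rs _) => address w (regs s) rs < S
  | _ => true
  end.

(* [k] instructions are executed before the final [Halt], hence [k < T].
   Space is the length of the initial segment of memory (input included) that
   contains every accessed cell; a program names only finitely many
   registers, so these add a constant. *)
Definition halts_within (w : nat) (P : program) (s : state) (v : bool)
    (T S : nat) : Prop :=
  exists k, [/\ k < T,
    fetch P (iter k (step w P) s) = Some (Halt v) &
    forall i, i < k -> access_below w P S (iter i (step w P) s)].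

(** * Input encoding *)

Definition words (w L x : nat) : seq nat :=
  mkseq (fun i => x %/ 2 ^ (w * i) %% 2 ^ w) L.

(* When [0 < w], an integer at most [c * 2 ^ w] is below [2 ^ (w * c.+1)]. *)
Definition nwords (c : nat) : nat := c.+1.

Definition perm_values (n : nat) (s : 'S_n) : seq nat :=
  [seq val (s i) | i <- enum 'I_n].

Definition input_ints (n d : nat) (a b : d.-tuple 'S_n) : seq nat :=
  [:: n, d & flatten (map (@perm_values n) a)
             ++ flatten (map (@perm_values n) b)].

Definition input_words (w L n d : nat) (a b : d.-tuple 'S_n) : seq nat :=
  flatten (map (words w L) (input_ints a b)).

Definition init_state (w L n d : nat) (a b : d.-tuple 'S_n) : state :=
  State 0 (fun=> 0) (nth 0 (input_words w L a b)).

(** * Permutations *)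

Definition is_ncycle (n : nat) (s : 'S_n) : Prop :=
  exists x : 'I_n, #|porbit s x| = n.

(* Main.v *)
(** For an [n]-cycle [a_j] let [x_i] be the image of point 0 under [a_j ^ i], and
    read the tuple [a] as the cyclic word whose [i]-th block lists the numbers
    [t - i mod n], where [a_k] maps [x_i] to [x_t], for all [k].  Simultaneous
    conjugators of [a] into [b] correspond to the rotations carrying the word
    of [a] to that of [b].  A separator letter [n] in front of every block
    forces rotations of the flattened words to respect the blocks.

    Equality of two words of length [N] up to rotation is decided with two
    candidate starting points [i] and [j] and a matched length [t].  When the
    letters at offset [t] differ, none of the [t + 1] starting points from the
    candidate with the larger letter on can give the least rotation, so they
    are skipped.  Every comparison increases [i + j + t] by one, which bounds
    the running time by [3 * N].

    The RAM has short words, so variables are blocks of boundedly many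
    registers and memory cells are blocks of as many words as an input
    integer. *)

Require Import Defs.
From mathcomp Require Import zify.

Set Implicit Arguments.
Unset Strict Implicit.
Unset Printing Implicit Defensive.

(** * Execution of code fragments *)

(** The index [j] with two [n]-cycles is promised but not given. It is searched for by following 0
    under [a_k] and [b_k] simultaneously, in [O(n)] time for each [k]. The index found may differ
    from the promised one, so the link with rotations is proved for every index at which both
    permutations are [n]-cycles.

    A simultaneous conjugator sends [x_i] to [y_(i+r)] for one fixed [r], where the [y_i] are the
    analogous points for [b_j]. The differences [t - i] do not change when [i] and [t] are shifted
    together, so [r] shows only as a rotation by [r] blocks.

    The comparison is sound because two words that are rotations of each other have the same set of
    rotations: a start giving the least one is beaten by no rotation of the other word, hence is
    never skipped. A candidate that reaches the length of the words thus refutes rotation.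

    The constant [c] in [n, d <= c * 2 ^ w] alone fixes how many words a variable or a cell takes.
    Multiword operations therefore unroll to boundedly many instructions, and no factor depending on
    [w] or [n] is lost. *)

Definition upd (f : nat -> nat) (r v : nat) : nat -> nat :=
  fun x => if x == r then v else f x.

Arguments upd f r v x /.

Section Execution.

Variables (w S : nat).

Definition exec (P : program) (s : state) (k : nat) (s' : state) : Prop :=
  iter k (step w P) s = s' /\
  forall i, i < k -> access_below w P S (iter i (step w P) s).

Lemma exec0 P s : exec P s 0 s.
Proof. by []. Qed.

Lemma exec_trans P s1 k1 s2 k2 s3 :
  exec P s1 k1 s2 -> exec P s2 k2 s3 -> exec P s1 (k1 + k2) s3.
Proof.
move=> [e1 a1] [e2 a2]; split=> [|i lti]; first by rewrite addnC iterD e1.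
have [/a1//|le_k1i] := ltnP i k1.
by rewrite -(subnK le_k1i) iterD e1; apply: a2; lia.
Qed.

Lemma exec1 P s : access_below w P S s -> exec P s 1 (step w P s).
Proof. by move=> a; split=> [|[|i]]. Qed.

Definition code_at (P : program) (b : nat) (cs : seq instr) : Prop :=
  forall i, i < size cs -> onth P (b + i) = onth cs i.

Lemma code_at_refl cs : code_at cs 0 cs.
Proof. by []. Qed.

Lemma code_at_cat P b cs1 cs2 :
  code_at P b (cs1 ++ cs2) ->
  code_at P b cs1 /\ code_at P (b + size cs1) cs2.
Proof.
rewrite /code_at size_cat => H; split=> i lti.
  by rewrite H ?onth_cat ?lti//; lia.
by rewrite -addnA H ?onth_cat ?ltnNge ?leq_addr ?addKn//; lia.
Qed.

Lemma code_at_cons P b c cs :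
  code_at P b (c :: cs) -> onth P b = Some c /\ code_at P b.+1 cs.
Proof.
move=> H; split; first by rewrite -[b]addn0 (H 0).
by move=> i lti; rewrite addSnnS (H i.+1).
Qed.

Definition all_words (f : nat -> nat) : Prop := forall r, f r < 2 ^ w.

Lemma eval_binop_word o x y :
  x < 2 ^ w -> y < 2 ^ w -> eval_binop w o x y < 2 ^ w.
Proof.
move=> ltx lty; case: o => /=; rewrite ?ltn_pmod ?expn_gt0//.
  by apply: leq_ltn_trans ltx; apply: leq_div.
by apply: leq_ltn_trans ltx; apply: leq_mod.
Qed.

Lemma all_words_set f r v :
  all_words f -> v < 2 ^ w -> all_words (upd f r v).
Proof. by move=> wf ltv x /=; case: eqP. Qed.

Lemma step_words P s :
  all_words (regs s) -> all_words (mem s) ->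
  all_words (regs (step w P s)) /\ all_words (mem (step w P s)).
Proof.
case: s => i f m /= wf wm.
case: fetch => [[r v|o r x y|r rs|rs r|l|x y l|x y l|v]|] //=; split=> //;
  apply: (@all_words_set _ _ _) => //; first by rewrite ltn_pmod ?expn_gt0.
exact: eval_binop_word.
Qed.

Lemma exec_words P s k s' :
  all_words (regs s) -> all_words (mem s) -> exec P s k s' ->
  all_words (regs s') /\ all_words (mem s').
Proof.
move=> wf wm [<- _]; elim: k => [//|k [wf' wm']] /=.
exact: step_words.
Qed.

(** Quantifying over the surrounding program and the position makes these facts compose under [++].
    Jump-free code takes exactly [size cs] steps. *)
Definition straight (cs : seq instr) (f m f' m' : nat -> nat) : Prop :=
  forall P b, code_at P b cs ->
  exec P (State b f m) (size cs) (State (b + size cs) f' m').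

Lemma straight_nil f m : straight [::] f m f m.
Proof. by move=> P b _; rewrite addn0; apply: exec0. Qed.

Lemma straight_cat cs1 cs2 f m f1 m1 f2 m2 :
  straight cs1 f m f1 m1 -> straight cs2 f1 m1 f2 m2 ->
  straight (cs1 ++ cs2) f m f2 m2.
Proof.
move=> H1 H2 P b /code_at_cat[/H1 e1 /H2 e2]; rewrite size_cat addnA.
exact: exec_trans e1 e2.
Qed.

Lemma straight_cons c cs f m f1 m1 f2 m2 :
  straight [:: c] f m f1 m1 -> straight cs f1 m1 f2 m2 ->
  straight (c :: cs) f m f2 m2.
Proof. exact: (@straight_cat [:: c]). Qed.

Lemma straight_words cs f m f' m' :
  all_words f -> all_words m -> straight cs f m f' m' ->
  all_words f' /\ all_words m'.
Proof.
move=> wf wm /(_ cs 0 (@code_at_refl cs)) e.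
exact: (exec_words (s := State 0 f m) wf wm e).
Qed.

Lemma straight1 c f m f' m' :
  (forall P b, onth P b = Some c ->
    access_below w P S (State b f m) /\
    step w P (State b f m) = State b.+1 f' m') ->
  straight [:: c] f m f' m'.
Proof.
move=> H P b /code_at_cons[/H[a e] _]; rewrite addn1 -e.
exact: exec1.
Qed.

Lemma straight_Const r v f m :
  straight [:: Const r v] f m (upd f r (v %% 2 ^ w)) m.
Proof. by apply: straight1 => P b e; rewrite /access_below /= /fetch /= e. Qed.

Lemma straight_Arith o r x y f m :
  straight [:: Arith o r x y] f m
    (upd f r (eval_binop w o (f x) (f y))) m.
Proof. by apply: straight1 => P b e; rewrite /access_below /= /fetch /= e. Qed.

Lemma straight_Read r rs f m :
  address w f rs < S ->
  straight [:: Read r rs] f m (upd f r (m (address w f rs))) m.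
Proof.
by move=> a; apply: straight1 => P b e; rewrite /access_below /= /fetch /= e.
Qed.

Lemma straight_Write r rs f m :
  address w f rs < S ->
  straight [:: Write rs r] f m f (upd m (address w f rs) (f r)).
Proof.
by move=> a; apply: straight1 => P b e; rewrite /access_below /= /fetch /= e.
Qed.

End Execution.

Section Address.

Variable w : nat.

Lemma address_cat f r1 r2 :
  address w f (r1 ++ r2) =
  address w f r1 + 2 ^ (w * size r1) * address w f r2.
Proof.
elim: r1 => [|r r1 IH] /=; first by rewrite muln0 expn0 mul1n.
by rewrite IH mulnS expnD; lia.
Qed.

Lemma eq_in_address f g rs :
  {in rs, f =1 g} -> address w f rs = address w g rs.
Proof.
elim: rs => //= r rs IH H; rewrite H ?mem_head// IH// => x xrs.
by rewrite H// inE xrs orbT.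
Qed.

Lemma address_map f h rs : address w f (map h rs) = address w (f \o h) rs.
Proof. by elim: rs => //= r rs ->. Qed.

Lemma address_lt f rs : all_words w f -> address w f rs < 2 ^ (w * size rs).
Proof.
move=> wf; elim: rs => [|r rs IH] /=; first by rewrite expn_gt0.
by rewrite mulnS expnD; have := wf r; nia.
Qed.

Lemma address0 f rs : {in rs, f =1 fun=> 0} -> address w f rs = 0.
Proof.
move/eq_in_address ->.
by elim: rs => //= r rs ->; rewrite muln0.
Qed.

Lemma address_iota_shift f i j L :
  address w f (iota (i + j) L) = address w (fun k => f (i + k)) (iota j L).
Proof. by rewrite iotaDl address_map. Qed.

End Address.

(** * Multiword arithmetic *)

Section Multiword.

Variables (w S K : nat).
Hypothesis w_gt0 : 0 < w.

Local Notation W := (2 ^ w).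

Let W_gt1 : 1 < W.
Proof. by rewrite -[1](expn0 2) ltn_exp2l. Qed.

Lemma lt_bit a z : a < W -> z < W ->
  (1 %/ ((a %/ z + 1) %% W) * (z %/ z)) %% W = (a < z).
Proof.
move=> lta ltz; case: z ltz => [|z] ltz; first by rewrite !divn0 muln0 mod0n.
rewrite divnn muln1; have [lt_az|le_za] := ltnP a z.+1.
  by rewrite (divn_small lt_az) (modn_small W_gt1) divn1 modn_small.
have : 0 < a %/ z.+1 by rewrite divn_gt0.
have : a %/ z.+1 <= a by apply: leq_div.
case: (a %/ z.+1) => // q leq _.
have [->|neq] := eqVneq (q.+1 + 1) W; first by rewrite modnn divn0 mod0n.
by rewrite (@modn_small (q.+1 + 1)) ?divn_small ?mod0n//; lia.
Qed.

(** A sum of words has wrapped exactly when it is smaller than a summand. If [y + z] wraps, the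
    residue is at most [W - 2], so adding the incoming carry cannot wrap again: the two overflow
    bits add up to a single carry. *)
Lemma add_with_carry y z c : y < W -> z < W -> c <= 1 ->
  let t := (y + z) %% W in let s := (t + c) %% W in
  s + W * (((t < y) + (s < t)) %% W) = y + z + c /\ (t < y) + (s < t) <= 1.
Proof.
move=> lty ltz lec t s.
have tE : t = if y + z < W then y + z else y + z - W.
  rewrite /t; case: ltnP => [/modn_small//|le].
  by rewrite -{1}(subnK le) modnDr modn_small//; lia.
have sE : s = if t + c < W then t + c else t + c - W.
  rewrite /s; case: ltnP => [/modn_small//|le].
  by rewrite -{1}(subnK le) modnDr modn_small//; move: tE; case: ifP; lia.
have le1 : (t < y) + (s < t) <= 1.
  by move: tE sE; case: ifP; case: ifP; lia.
rewrite (@modn_small (_ + _)) ?(leq_ltn_trans le1)//; split=> //.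
by move: tE sE le1; case: ifP; case: ifP; nia.
Qed.

(* Registers: 0 carry, 5 the constant 1, 6 the constant 0, 7 the largest word,
   the others below 10 are temporary.  The comparison [a < z] is computed
   without a branch as [(1 / (a / z + 1)) * (z / z)]; division by zero makes
   this right also when [z = 0] or [a / z + 1] wraps around. *)
Definition lt_code (q a z : reg) : seq instr :=
  [:: Arith Div q a z; Arith Add q q 5; Arith Div q 5 q; Arith Div 4 z z;
      Arith Mul q q 4].

Definition add_digit (d y z : reg) : seq instr :=
  [:: Arith Add 1 y z; Arith Add 8 y 6; Arith Add 2 1 0]
  ++ lt_code 3 1 8 ++ lt_code 0 2 1
  ++ [:: Arith Add 0 0 3; Arith Add d 2 6].

Arguments add_digit : simpl never.

Lemma straight_arith o r x y v cs f m f' m' :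
  eval_binop w o (f x) (f y) = v ->
  straight w S cs (upd f r v) m f' m' ->
  straight w S (Arith o r x y :: cs) f m f' m'.
Proof. by move=> <-; apply: straight_cons; apply: straight_Arith. Qed.

Lemma straight_lt_code q a z f m :
  all_words w f -> f 5 = 1 -> a != q -> z != q -> uniq [:: 5; 4; q] ->
  a != 4 -> z != 4 ->
  exists f', [/\ straight w S (lt_code q a z) f m f' m,
    f' q = (f a < f z) & forall r, r != q -> r != 4 -> f' r = f r].
Proof.
move=> wf f5 aq zq /and3P[q54 q4 _] a4 z4.
have {q54}[q5 {}q4] : (5 == q) = false /\ (4 == q) = false.
  by move: q54 q4; rewrite !inE; do 2 case: (_ == q).
have {}aq := negPf aq; have {}zq := negPf zq.
have q4' : (q == 4) = false by rewrite eq_sym.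
eexists; split.
- apply: (straight_arith (v := f a %/ f z)) => //.
  apply: (straight_arith (v := (f a %/ f z + 1) %% W)).
    by rewrite /= eqxx q5 f5.
  apply: (straight_arith (v := 1 %/ ((f a %/ f z + 1) %% W))).
    by rewrite /= eqxx q5 f5.
  apply: (straight_arith (v := f z %/ f z)); first by rewrite /= zq.
  apply: (straight_arith (v := nat_of_bool (f a < f z))); last exact: straight_nil.
  by rewrite /= eqxx q4' lt_bit.
- by rewrite /= eqxx.
- by move=> r /negPf rq /negPf r4; rewrite /= rq r4.
Qed.

Lemma straight_add_digit d y z f m :
  all_words w f -> all_words w m -> f 5 = 1 -> f 6 = 0 -> f 0 <= 1 ->
  9 < d -> 9 < y -> 9 < z ->
  exists f', [/\ straight w S (add_digit d y z) f m f' m,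
    f' d + W * f' 0 = f y + f z + f 0,
    f' 0 <= 1, f' 5 = 1 /\ f' 6 = 0 &
    forall r, 9 < r -> r != d -> f' r = f r].
Proof.
move=> wf wm f5 f6 f0 gtd gty gtz.
have dF k : k < 10 -> (k == d) = false by lia.
have y1 : (y == 1) = false by lia.
pose t := (f y + f z) %% W; pose s := (t + f 0) %% W.
pose f1 := upd (upd (upd f 1 t) 8 (f y)) 2 s.
have wf1 : all_words w f1.
  by do 3 (apply all_words_set; rewrite ?ltn_pmod ?expn_gt0//).
have [//|//|//|//|//|//|f2 [st2 f2v f2E]] :=
  @straight_lt_code 3 1 8 f1 m wf1.
have [wf2 _] := straight_words wf1 wm st2.
have f25 : f2 5 = 1 by rewrite f2E.
have [//|//|//|//|//|f3 [st3 f3v f3E]] := @straight_lt_code 0 2 1 f2 m wf2 f25.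
have [eq_sum le1] := add_with_carry (wf y) (wf z) f0.
rewrite -/t -/s in eq_sum le1.
have f33 : f3 3 = (t < f y) by rewrite f3E// f2v.
have f30 : f3 0 = (s < t) by rewrite f3v !f2E.
have f32 : f3 2 = s by rewrite f3E// f2E.
have f35 : f3 5 = 1 by rewrite f3E// f2E.
have f36 : f3 6 = 0 by rewrite f3E// f2E.
pose c := ((t < f y) + (s < t)) %% W.
exists (upd (upd f3 0 c) d s); split.
- rewrite /add_digit.
  apply: (straight_arith (v := t)) => //.
  apply: (straight_arith (v := f y)).
    by rewrite /= y1 f6 addn0 modn_small.
  apply: (straight_arith (v := s)) => //.
  apply: straight_cat st2 _; apply: straight_cat st3 _.
  apply: (straight_arith (v := c)); first by rewrite /= f30 f33 addnC.
  apply: (straight_arith (v := s)); last exact: straight_nil.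
  by rewrite /= f32 f36 addn0 modn_small// ltn_pmod ?expn_gt0.
- by rewrite /= eqxx dF.
- by rewrite /= dF// /c modn_small// (leq_ltn_trans le1).
- by rewrite /= !dF.
- move=> r gtr rd; have rF k : k < 10 -> (r == k) = false by lia.
  rewrite /= (negPf rd) rF// f3E ?rF// f2E ?rF//.
  by rewrite /f1 /= !rF.
Qed.

Fixpoint add_code (k : nat) (d y z : reg) : seq instr :=
  if k is k'.+1 then add_digit d y z ++ add_code k' d.+1 y.+1 z.+1 else [::].

Lemma size_add_code k d y z : size (add_code k d y z) = 15 * k.
Proof.
elim: k d y z => // k IH d y z.
by rewrite mulnS -(IH d.+1 y.+1 z.+1); exact: (size_cat (add_digit d y z)).
Qed.

(** Words are processed from the least significant one upward. A destination at or below the source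
    overwrites only words that are already consumed; otherwise it has to start past the source. *)
Definition no_clobber (k d y : nat) : bool := (d <= y) || (y + k <= d).

Lemma straight_add_code k d y z f m :
  all_words w f -> all_words w m -> f 5 = 1 -> f 6 = 0 -> f 0 <= 1 ->
  9 < d -> 9 < y -> 9 < z -> no_clobber k d y -> no_clobber k d z ->
  exists f', [/\ straight w S (add_code k d y z) f m f' m,
    address w f' (iota d k) + 2 ^ (w * k) * f' 0 =
      address w f (iota y k) + address w f (iota z k) + f 0,
    f' 0 <= 1, f' 5 = 1 /\ f' 6 = 0 &
    forall r, 9 < r -> (r < d) || (d + k <= r) -> f' r = f r].
Proof.
move=> + wm; elim: k d y z f => [|k IH] d y z f wf f5 f6 f0 gtd gty gtz dy dz.
  by exists f; split=> //; [exact: straight_nil | rewrite muln0 mul1n].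
have [f1 [st1 f1v f10 [f15 f16] f1E]] :=
  straight_add_digit wf wm f5 f6 f0 gtd gty gtz.
have [wf1 _] := straight_words wf wm st1.
have dy1 : no_clobber k d.+1 y.+1 by move: dy; rewrite /no_clobber; lia.
have dz1 : no_clobber k d.+1 z.+1 by move: dz; rewrite /no_clobber; lia.
have [f2 [st2 f2v f20 [f25 f26] f2E]] :=
  IH _ _ _ _ wf1 f15 f16 f10 (leqW gtd) (leqW gty) (leqW gtz) dy1 dz1.
exists f2; split=> //; first exact: straight_cat st1 st2.
- have same x : 9 < x -> no_clobber k.+1 d x ->
    address w f1 (iota x.+1 k) = address w f (iota x.+1 k).
    move=> gtx dx; apply: eq_in_address => r; rewrite mem_iota => /andP[ltr rlt].
    by apply: f1E; move: dx; rewrite /no_clobber; lia.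
  rewrite /= f2E; [|lia..].
  rewrite mulnS expnD -mulnA -addnA -mulnDr f2v !same//.
  by move: f1v; nia.
- by move=> r gtr rP; rewrite f2E ?f1E//; lia.
Qed.

(* Variable [x] of [K] words; variables 0 and 1 are temporary. *)
Definition loc (x : nat) : reg := 10 + K * x.

Definition mval (f : nat -> nat) (x : nat) : nat :=
  address w f (iota (loc x) K).

Lemma loc_gt9 x : 9 < loc x.
Proof. by rewrite /loc leq_addr. Qed.

Lemma no_clobber_loc x y : no_clobber K (loc x) (loc y).
Proof.
rewrite /no_clobber /loc; have [le|lt] := leqP x y.
  by rewrite leq_add2l leq_mul.
by have := leq_mul (leqnn K) lt; rewrite mulnS; lia.
Qed.

Lemma mval_eq f f' x y : x != y ->
  (forall r, 9 < r -> (r < loc x) || (loc x + K <= r) -> f' r = f r) ->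
  mval f' y = mval f y.
Proof.
clear w_gt0 W_gt1 => xy H; apply: eq_in_address => r.
rewrite mem_iota => /andP[ler rlt]; apply: H; first exact: leq_trans (loc_gt9 y) ler.
move: ler rlt; rewrite /loc; move: xy; rewrite neq_ltn => /orP[]; nia.
Qed.

Lemma mval_lt f x : all_words w f -> mval f x < 2 ^ (w * K).
Proof. by move=> wf; have := address_lt (iota (loc x) K) wf; rewrite size_iota. Qed.

Definition add_block (b : bool) (x y z : nat) : seq instr :=
  [:: Const 5 1; Const 6 0; Const 0 b] ++ add_code K (loc x) (loc y) (loc z).

Lemma size_add_block b x y z : size (add_block b x y z) = 3 + 15 * K.
Proof. by rewrite size_cat size_add_code. Qed.

Lemma straight_add_block (b : bool) x y z f m :
  all_words w f -> all_words w m -> mval f y + mval f z + b < 2 ^ (w * K) ->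
  exists f', [/\ straight w S (add_block b x y z) f m f' m,
    mval f' x = mval f y + mval f z + b &
    forall r, 9 < r -> (r < loc x) || (loc x + K <= r) -> f' r = f r].
Proof.
move=> wf wm lt_sum.
pose f0 := upd (upd (upd f 5 1) 6 0) 0 b.
have f0E r : 9 < r -> f0 r = f r.
  move=> gtr; have rF k : k < 10 -> (r == k) = false by lia.
  by rewrite /f0 /= !rF.
have bW : b < W by exact: leq_ltn_trans (leq_b1 b) W_gt1.
have wf0 : all_words w f0.
  by do 3 (apply all_words_set; rewrite ?expn_gt0//).
have v0 x' : mval f0 x' = mval f x'.
  apply: eq_in_address => r; rewrite mem_iota => /andP[ler _].
  by rewrite f0E// (leq_trans (loc_gt9 x')).
have [f1 [st1 f1v _ _ f1E]] :=
  @straight_add_code K _ _ _ f0 m wf0 wm erefl erefl (leq_b1 b) (loc_gt9 x)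
    (loc_gt9 y) (loc_gt9 z) (no_clobber_loc x y) (no_clobber_loc x z).
have [wf1 _] := straight_words wf0 wm st1.
exists f1; split=> //.
- rewrite /add_block; apply: straight_cat st1.
  have -> : f0 = upd (upd (upd f 5 (1 %% W)) 6 (0 %% W)) 0 (b %% W).
    by rewrite !modn_small// ?expn_gt0.
  do 3 (apply: straight_cons; first exact: straight_Const).
  exact: straight_nil.
(* A positive outgoing carry would make the sum reach [2 ^ (w * K)], against [lt_sum]. *)
- move: f1v; rewrite -!/(mval _ _) !v0 /=.
  move: lt_sum; case: (f1 0) => [|c]; first by rewrite muln0 addn0.
  rewrite /f0 /= mulnS => + eqv; rewrite -eqv -/(mval _ _) => lt_sum; exfalso.
  by move: lt_sum; rewrite addnCA -ltn_subRL subnn.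
- by move=> r gtr rP; rewrite f1E// f0E.
Qed.

Fixpoint compl_code (k : nat) (d z : reg) : seq instr :=
  if k is k'.+1 then Arith Sub d 7 z :: compl_code k' d.+1 z.+1 else [::].

Lemma size_compl_code k d z : size (compl_code k d z) = k.
Proof. by elim: k d z => //= k IH d z; rewrite IH. Qed.

Lemma straight_compl_code k d z f m :
  all_words w f -> f 7 = W.-1 -> 9 < d -> 9 < z -> no_clobber k d z ->
  exists f', [/\ straight w S (compl_code k d z) f m f' m,
    (address w f' (iota d k) + address w f (iota z k)).+1 = 2 ^ (w * k) &
    forall r, (r < d) || (d + k <= r) -> f' r = f r].
Proof.
elim: k d z f => [|k IH] d z f wf f7 gtd gtz dz.
  by exists f; split=> //; [exact: straight_nil | rewrite muln0].
pose v := W.-1 - f z.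
have fz := wf z.
have vE : eval_binop w Sub (f 7) (f z) = v.
  rewrite /= f7 /v (_ : _ + _ = W + (W.-1 - f z)); last by lia.
  by rewrite modnDl modn_small//; lia.
pose f1 := upd f d v.
have f1E r : r != d -> f1 r = f r by move=> /negPf rd; rewrite /f1 /= rd.
have wf1 : all_words w f1 by apply all_words_set => //; rewrite /v; lia.
have dz1 : no_clobber k d.+1 z.+1 by move: dz; rewrite /no_clobber; lia.
have f17 : f1 7 = W.-1 by rewrite f1E//; lia.
have [f2 [st2 f2v f2E]] := IH _ _ _ wf1 f17 (leqW gtd) (leqW gtz) dz1.
exists f2; split.
- exact: straight_arith vE st2.
- have same : address w f1 (iota z.+1 k) = address w f (iota z.+1 k).
    apply: eq_in_address => r; rewrite mem_iota => /andP[ltr rlt].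
    by apply: f1E; move: dz; rewrite /no_clobber; lia.
  rewrite /= f2E; [|lia..].
  rewrite mulnS expnD -f2v same /f1 /= eqxx /v.
  by move: fz; move: W W_gt1 => M M1; nia.
- by move=> r rP; rewrite f2E ?f1E//; lia.
Qed.

(* [y - z] is [y + (2 ^ (w * K) - 1 - z) + 1], whose carry tells whether
   [z <= y]. *)
Definition sub_block (x y z : nat) : seq instr :=
  [:: Const 5 1; Const 6 0; Arith Sub 7 6 5] ++ compl_code K (loc 1) (loc z)
  ++ Const 0 1 :: add_code K (loc x) (loc y) (loc 1).

Lemma size_sub_block x y z : size (sub_block x y z) = 4 + 16 * K.
Proof.
by clear w_gt0 W_gt1; rewrite 2!size_cat size_compl_code /= size_add_code; lia.
Qed.

(** The carry is described also for [y < z], where the difference is meaningless, so that the same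
    block serves as a comparison. The condition [y != 1] is there because the complement of [z] goes
    to variable 1 before [y] is read. *)
Lemma straight_sub_block x y z f m :
  all_words w f -> all_words w m -> y != 1 ->
  exists f', [/\ straight w S (sub_block x y z) f m f' m,
    f' 0 = (mval f z <= mval f y), f' 5 = 1,
    mval f z <= mval f y -> mval f' x = mval f y - mval f z &
    forall u, u != x -> u != 1 -> mval f' u = mval f u].
Proof.
move=> wf wm y1.
pose f0 := upd (upd (upd f 5 1) 6 0) 7 W.-1.
have f0E r : 9 < r -> f0 r = f r.
  move=> gtr; have rF k : k < 10 -> (r == k) = false by lia.
  by rewrite /f0 /= !rF.
have wf0 : all_words w f0.
  by do 3 (apply all_words_set; rewrite ?expn_gt0// ?prednK ?expn_gt0//).
have v0 x' : mval f0 x' = mval f x'.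
  apply: eq_in_address => r; rewrite mem_iota => /andP[ler _].
  by rewrite f0E// (leq_trans (loc_gt9 x')).
have [f1 [st1 f1v f1E]] := straight_compl_code m wf0 erefl (loc_gt9 1)
  (loc_gt9 z) (no_clobber_loc 1 z).
have [wf1 _] := straight_words wf0 wm st1.
have lt_loc k : k < 10 -> k < loc 1 by move=> lt; apply: leq_trans (loc_gt9 1).
pose f2 := upd f1 0 1.
have wf2 : all_words w f2 by apply all_words_set.
have f2E r : 0 < r -> f2 r = f1 r by rewrite /f2 /=; case: r.
have v2 x' : mval f2 x' = mval f1 x'.
  apply: eq_in_address => r; rewrite mem_iota => /andP[ler _].
  by rewrite f2E// (leq_trans _ ler)// (leq_trans _ (loc_gt9 x')).
have f25 : f2 5 = 1 by rewrite f2E// f1E ?lt_loc.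
have f26 : f2 6 = 0 by rewrite f2E// f1E ?lt_loc.
have [f3 [st3 f3v f30 [f35 _] f3E]] :=
  @straight_add_code K _ _ _ f2 m wf2 wm f25 f26 (leqnn 1) (loc_gt9 x)
    (loc_gt9 y) (loc_gt9 1) (no_clobber_loc x y) (no_clobber_loc x 1).
have [wf3 _] := straight_words wf2 wm st3.
rewrite -!/(mval _ _) !v2 v0 in f1v f3v.
have y2 : mval f1 y = mval f y.
  by rewrite -(v0 y); apply: (@mval_eq f0 f1 1) => [|r _ /f1E//]; rewrite eq_sym.
rewrite y2 {1}/f2 /= in f3v.
have v3 := mval_lt x wf3; have vy := mval_lt y wf; have vz := mval_lt z wf.
exists f3; split=> //.
- rewrite /sub_block; apply: straight_cat (straight_cat st1 _).
    have -> : f0 = upd (upd (upd f 5 (1 %% W)) 6 (0 %% W)) 7 W.-1.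
      by rewrite !modn_small// expn_gt0.
    apply: straight_cons; first exact: straight_Const.
    apply: straight_cons; first exact: straight_Const.
    apply: (straight_arith (v := W.-1)); last exact: straight_nil.
    by rewrite /= mod0n add0n !modn_small// ?subn1//; lia.
  apply: straight_cons st3.
  have -> : f2 = upd f1 0 (1 %% W) by rewrite modn_small.
  exact: straight_Const.
- move: f30 f3v f1v v3 vy vz; case: (f3 0) => [|[|//]] _;
    move: (2 ^ (w * K)) => M; case: leqP => //=; lia.
- move: f30 f3v f1v v3 vy vz; case: (f3 0) => [|[|//]] _;
    move: (2 ^ (w * K)) => M; lia.
- move=> u ux u1; rewrite -(v0 u) -(@mval_eq f0 f1 1 u) => [||r _ /f1E//];
    last by rewrite eq_sym.
  by rewrite -(v2 u); apply: (@mval_eq f2 f3 x) => //; rewrite eq_sym.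
Qed.

End Multiword.

(** * Multiword memory access *)

Section Memory.

Variables (w S K L : nat).
Hypotheses (w_gt0 : 0 < w) (S_lt : S < 2 ^ (w * K)) (le_LK : L <= K).

Local Notation mval := (mval w K).
Local Notation loc := (loc K).
Local Notation straight := (straight w S).
Local Notation add_block := (add_block K).

Lemma straight_add_var (b : bool) x y z f m :
  all_words w f -> all_words w m -> mval f y + mval f z + b < 2 ^ (w * K) ->
  exists f', [/\ straight (add_block b x y z) f m f' m, all_words w f',
    mval f' x = mval f y + mval f z + b &
    forall u, u != x -> mval f' u = mval f u].
Proof.
move=> wf wm lt_sum.
have [f1 [st1 v1 f1E]] := straight_add_block S w_gt0 x wf wm lt_sum.
exists f1; split=> // [|u ux]; first by have [] := straight_words wf wm st1.
by apply: mval_eq f1E; rewrite eq_sym.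
Qed.

(** A cell number becomes an address by a factor [L]. As [L] is fixed in the program text, repeated
    addition has constant cost. *)
Fixpoint scale_code (l y : nat) : seq instr :=
  if l is l'.+1 then add_block false 0 0 y ++ scale_code l' y else [::].

Lemma straight_scale_code l y f m :
  all_words w f -> all_words w m -> y != 0 ->
  mval f 0 + l * mval f y < 2 ^ (w * K) ->
  exists f', [/\ straight (scale_code l y) f m f' m, all_words w f',
    mval f' 0 = mval f 0 + l * mval f y &
    forall u, u != 0 -> mval f' u = mval f u].
Proof.
move=> + wm y0; elim: l f => [|l IH] f wf lt_sum.
  by exists f; split=> //; [exact: straight_nil | rewrite addn0].
have lt1 : mval f 0 + mval f y + 0 < 2 ^ (w * K).
  by apply: leq_ltn_trans lt_sum; rewrite addn0 mulSn leq_add2l leq_addr.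
have [f1 [st1 wf1 v10 v1]] := straight_add_var (b := false) 0 wf wm lt1.
have [|f2 [st2 wf2 v20 v2]] := IH f1 wf1.
  by rewrite v10 v1// addn0 -addnA -mulSn.
exists f2; split=> // [||u u0]; first exact: straight_cat st1 st2.
  by rewrite v20 v10 v1// addn0 -addnA -mulSn.
by rewrite v2// v1.
Qed.

(* Variable 2 always holds zero. *)
Definition addr_block (y : nat) : seq instr :=
  add_block false 0 2 2 ++ scale_code L y.

Lemma straight_addr_block y f m :
  all_words w f -> all_words w m -> y != 0 -> mval f 2 = 0 ->
  L * mval f y < 2 ^ (w * K) ->
  exists f', [/\ straight (addr_block y) f m f' m, all_words w f',
    mval f' 0 = L * mval f y & forall u, u != 0 -> mval f' u = mval f u].
Proof.
move=> wf wm y0 f2 lt_a.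
have [|f1 [st1 wf1 v10 v1]] := straight_add_var (b := false) 0 wf wm (y := 2) (z := 2).
  by rewrite f2 expn_gt0.
have {}v10 : mval f1 0 = 0 by rewrite v10 f2.
have [|f3 [st3 wf3 v30 v3]] := straight_scale_code (l := L) wf1 wm y0.
  by rewrite v10 v1.
exists f3; split=> // [||u u0]; first exact: straight_cat st1 st3.
  by rewrite v30 v10 v1.
by rewrite v3// v1.
Qed.

(** Adding the zero variable with incoming carry 1 advances the address held in variable 0. *)
Fixpoint read_code (l : nat) (r : reg) : seq instr :=
  if l is l'.+1 then
    Read r (iota (loc 0) K) :: add_block true 0 0 2 ++ read_code l' r.+1
  else [::].

(** The conditions on [r] keep the destination away from variable 0, the running address, and from
    variable 2, which has to stay zero. *)
Lemma straight_read_code l r f m :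
  all_words w f -> all_words w m -> mval f 2 = 0 ->
  loc 1 <= r -> (r + l <= loc 2) || (loc 3 <= r) -> mval f 0 + l <= S ->
  exists f', [/\ straight (read_code l r) f m f' m, all_words w f',
    address w f' (iota r l) = address w m (iota (mval f 0) l) &
    forall r', loc 1 <= r' -> (r' < r) || (r + l <= r') -> f' r' = f r'].
Proof.
move=> + wm; elim: l r f => [|l IH] r f wf f2 le1r rP leS.
  by exists f; split=> //; exact: straight_nil.
pose f1 := upd f r (m (mval f 0)).
have f1E r' : r' != r -> f1 r' = f r' by rewrite /f1 /= => /negPf->.
have wf1 : all_words w f1 by apply all_words_set.
have v1 u : (loc u + K <= r) || (r < loc u) -> mval f1 u = mval f u.
  move=> uP; apply: eq_in_address => r'; rewrite mem_iota => r'P.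
  by apply: f1E; lia.
have loc0 : loc 0 + K = loc 1 by rewrite /loc; lia.
have loc2 : loc 2 + K = loc 3 by rewrite /loc; lia.
have v10 : mval f1 0 = mval f 0 by apply: v1; lia.
have v12 : mval f1 2 = 0 by rewrite v1 ?f2//; lia.
have [|f3 [st3 v30 f3E]] :=
  straight_add_block (K := K) (b := true) S w_gt0 0 wf1 wm (y := 0) (z := 2).
  by rewrite v10 v12; lia.
have [wf3 _] := straight_words wf1 wm st3.
have v3 u : u != 0 -> mval f3 u = mval f1 u.
  by move=> u0; apply: mval_eq f3E; rewrite eq_sym.
have f3E' r' : loc 1 <= r' -> f3 r' = f1 r'.
  by move=> ler; apply: f3E; rewrite ?loc0 ?ler ?orbT// (leq_trans _ ler)// loc_gt9.
have {}v30 : mval f3 0 = (mval f 0).+1 by rewrite v30 v10 v12; lia.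
have [||||f4 [st4 wf4 v4 f4E]] := IH r.+1 f3 wf3.
- by rewrite v3.
- exact: leqW.
- by lia.
- by rewrite v30; lia.
exists f4; split=> //.
- apply: straight_cons; first by apply: straight_Read; rewrite -/(mval _ _); lia.
  exact: straight_cat st3 st4.
- rewrite /= f4E ?ltnSn// f3E'// {1}/f1 /= eqxx v4 v30.
  by [].
- by move=> r' ler r'P; rewrite f4E ?f3E' ?f1E//; lia.
Qed.

Fixpoint zero_code (l : nat) (r : reg) : seq instr :=
  if l is l'.+1 then Const r 0 :: zero_code l' r.+1 else [::].

Lemma straight_zero_code l r f m :
  exists f', [/\ straight (zero_code l r) f m f' m,
    {in iota r l, f' =1 fun=> 0} &
    forall r', (r' < r) || (r + l <= r') -> f' r' = f r'].
Proof.
elim: l r f => [|l IH] r f; first by exists f; split=> //; exact: straight_nil.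
have [f1 [st1 z1 f1E]] := IH r.+1 (upd f r (0 %% 2 ^ w)).
exists f1; split.
- by apply: straight_cons st1; exact: straight_Const.
- move=> r'; rewrite inE => /orP[/eqP->|/z1//].
  by rewrite f1E ?ltnSn// /= eqxx mod0n.
- move=> r' r'P; rewrite f1E /=; last by lia.
  by case: eqP => // ?; lia.
Qed.

Definition load_block (x y : nat) : seq instr :=
  addr_block y ++ read_code L (loc x) ++ zero_code (K - L) (loc x + L).

Lemma straight_load_block x y f m :
  all_words w f -> all_words w m -> mval f 2 = 0 -> 2 < x -> y != 0 ->
  L * (mval f y).+1 <= S ->
  exists f', [/\ straight (load_block x y) f m f' m, all_words w f',
    mval f' x = address w m (iota (L * mval f y) L) &
    forall u, u != 0 -> u != x -> mval f' u = mval f u].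
Proof.
move=> wf wm f2 gtx y0; rewrite mulnS => leS.
have [|f1 [st1 wf1 v10 v1]] := straight_addr_block wf wm y0 f2; first by lia.
have loc_le u v : u <= v -> loc u <= loc v.
  by move=> le; rewrite leq_add2l leq_mul.
have locS u : loc u + K = loc u.+1 by rewrite /loc; lia.
have [||||f3 [st3 wf3 v3 f3E]] := @straight_read_code L (loc x) f1 m wf1 wm.
- by rewrite v1.
- by apply: loc_le; lia.
- by rewrite loc_le ?orbT.
- by rewrite v10; lia.
have [f4 [st4 z4 f4E]] := straight_zero_code (K - L) (loc x + L) f3 m.
have st : straight (load_block x y) f m f4 m.
  exact: straight_cat st1 (straight_cat st3 st4).
have [wf4 _] := straight_words wf wm st.
exists f4; split=> //.
- rewrite /mval -{2}(subnKC le_LK) iotaD address_cat (address0 w z4) muln0 addn0.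
  rewrite -v10 -v3; apply: eq_in_address => r; rewrite mem_iota => rP.
  by apply: f4E; lia.
- move=> u u0 ux; rewrite -v1//; apply: eq_in_address => r.
  rewrite mem_iota locS => /andP[ler rlt].
  have le1r : loc 1 <= r by apply: leq_trans ler; apply: loc_le; lia.
  have rP : (r < loc x) || (loc x + K <= r).
    move: ux; rewrite neq_ltn => /orP[lt|gt].
      by rewrite (leq_trans rlt)// loc_le.
    by rewrite locS (leq_trans _ ler) ?orbT// loc_le.
  by rewrite f4E ?f3E//; lia.
Qed.

Fixpoint write_code (l : nat) (r : reg) : seq instr :=
  if l is l'.+1 then
    Write (iota (loc 0) K) r :: add_block true 0 0 2 ++ write_code l' r.+1
  else [::].

Lemma straight_write_code l r f m :
  all_words w f -> all_words w m -> mval f 2 = 0 ->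
  loc 1 <= r -> mval f 0 + l <= S ->
  exists f' m', [/\ straight (write_code l r) f m f' m',
    all_words w f' /\ all_words w m',
    address w m' (iota (mval f 0) l) = address w f (iota r l),
    forall p, (p < mval f 0) || (mval f 0 + l <= p) -> m' p = m p &
    forall u, u != 0 -> mval f' u = mval f u].
Proof.
elim: l r f m => [|l IH] r f m wf wm f2 le1r leS.
  by exists f, m; split=> //; exact: straight_nil.
pose m1 := upd m (mval f 0) (f r).
have wm1 : all_words w m1 by apply all_words_set.
have loc0 : loc 0 + K = loc 1 by rewrite /loc; lia.
have [|f3 [st3 v30 f3E]] :=
  straight_add_block (K := K) (b := true) S w_gt0 0 wf wm1 (y := 0) (z := 2).
  by rewrite f2; lia.
have [wf3 _] := straight_words wf wm1 st3.
have v3 u : u != 0 -> mval f3 u = mval f u.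
  by move=> u0; apply: mval_eq f3E; rewrite eq_sym.
have f3E' r' : loc 1 <= r' -> f3 r' = f r'.
  by move=> ler; apply: f3E; rewrite ?loc0 ?ler ?orbT// (leq_trans _ ler)// loc_gt9.
have {}v30 : mval f3 0 = (mval f 0).+1 by rewrite v30 f2; lia.
have [|||f4 [m4 [st4 [wf4 wm4] a4 m4E v4]]] := IH r.+1 f3 m1 wf3 wm1.
- by rewrite v3.
- exact: leqW.
- by rewrite v30; lia.
exists f4, m4; split=> //.
- apply: straight_cons; first by apply: straight_Write; rewrite -/(mval _ _); lia.
  exact: straight_cat st3 st4.
- rewrite v30 in a4 m4E; rewrite /= a4 m4E ?ltnSn// /m1 /= eqxx.
  congr (_ + _ * _); apply: eq_in_address => r'; rewrite mem_iota => r'P.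
  by apply: f3E'; lia.
- move=> p pP; rewrite m4E ?v30 /m1 /=; last by lia.
  by case: eqP => // ?; lia.
- by move=> u u0; rewrite v4// v3.
Qed.

Definition store_block (x y : nat) : seq instr :=
  addr_block x ++ write_code L (loc y).

Lemma straight_store_block x y f m :
  all_words w f -> all_words w m -> mval f 2 = 0 -> x != 0 -> y != 0 ->
  L * (mval f x).+1 <= S -> mval f y < 2 ^ (w * L) ->
  exists f' m', [/\ straight (store_block x y) f m f' m',
    all_words w f' /\ all_words w m',
    address w m' (iota (L * mval f x) L) = mval f y,
    forall p, (p < L * mval f x) || (L * mval f x + L <= p) -> m' p = m p &
    forall u, u != 0 -> mval f' u = mval f u].
Proof.
move=> wf wm f2 x0 y0; rewrite mulnS => leS lty.
have [|f1 [st1 wf1 v10 v1]] := straight_addr_block wf wm x0 f2; first by lia.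
have loc1y : loc 1 <= loc y by rewrite leq_add2l leq_mul// lt0n.
have [||f3 [m3 [st3 [wf3 wm3] a3 m3E v3]]] :=
  straight_write_code (l := L) wf1 wm _ loc1y; first by rewrite v1.
  by rewrite v10; lia.
rewrite v10 in a3 m3E.
exists f3, m3; split=> //; first exact: straight_cat st1 st3.
(* The bound on the value of [y] forces its top [K - L] words to vanish, so storing the low [L]
   words loses nothing. *)
- have vE : mval f1 y = address w f1 (iota (loc y) L)
      + 2 ^ (w * L) * address w f1 (iota (loc y + L) (K - L)).
    by rewrite /mval -{2}(subnKC le_LK) iotaD address_cat size_iota.
  rewrite a3; move: lty; rewrite -(v1 y)// vE.
  case: (address _ _ (iota (_ + L) _)) => [|h]; first by rewrite muln0 addn0.
  by rewrite mulnS addnCA -ltn_subRL subnn.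
- by move=> u u0; rewrite v3// v1.
Qed.

End Memory.

(** * Structured programs *)

Arguments add_block : simpl never.
Arguments sub_block : simpl never.
Arguments load_block : simpl never.
Arguments store_block : simpl never.

Inductive cmd :=
  | CSkip
  | CAdd of bool & nat & nat & nat
  | CSub of nat & nat & nat
  | CLoad of nat & nat
  | CStore of nat & nat
  | CSeq of cmd & cmd
  | CIf of nat & nat & cmd & cmd
  | CWhile of seq (nat * nat) & cmd.

Record vstate := VState { vars : nat -> nat; cells : nat -> nat }.

Definition set_var (s : vstate) (x v : nat) : vstate :=
  VState (upd (vars s) x v) (cells s).

Definition set_cell (s : vstate) (p v : nat) : vstate :=
  VState (vars s) (upd (cells s) p v).

Definition lt_vars (s : vstate) (xy : nat * nat) : bool :=
  vars s xy.1 < vars s xy.2.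

Section Compiler.

Variables (w S K L : nat).
Hypotheses (w_gt0 : 0 < w) (S_lt : S < 2 ^ (w * K)) (le_LK : L <= K).

(** The subtraction leaves carry 1 in register 0 exactly when the value of [y] is at most that of
    [x], and register 5 holds 1. The jump is thus taken when the test [x < y] fails; the difference
    itself is discarded in temporary variable 1. *)
Definition lt_block (x y : nat) (l : nat) : seq instr :=
  sub_block K 1 x.+2 y.+2 ++ [:: JumpEq 0 5 l].

Arguments lt_block : simpl never.

Fixpoint lt_blocks (cs : seq (nat * nat)) (l : nat) : seq instr :=
  if cs is xy :: cs' then lt_block xy.1 xy.2 l ++ lt_blocks cs' l else [::].

(* Two machine variables are temporary, so that variable [x] is machine
   variable [x.+2]; variable 0 is never written and remains zero. *)
Fixpoint compile (b : nat) (c : cmd) : seq instr :=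
  match c with
  | CSkip => [::]
  | CAdd i x y z => add_block K i x.+2 y.+2 z.+2
  | CSub x y z => sub_block K x.+2 y.+2 z.+2
  | CLoad x y => load_block K L x.+2 y.+2
  | CStore x y => store_block K L x.+2 y.+2
  | CSeq c1 c2 =>
      let p1 := compile b c1 in p1 ++ compile (b + size p1) c2
  | CIf x y c1 c2 =>
      let b1 := b + (5 + 16 * K) in
      let p1 := compile b1 c1 in
      let b2 := b1 + (size p1).+1 in
      let p2 := compile b2 c2 in
      lt_block x y b2 ++ p1 ++ Jump (b2 + size p2) :: p2
  | CWhile cs c1 =>
      let b1 := b + (5 + 16 * K) * size cs in
      let p1 := compile b1 c1 in
      lt_blocks cs (b1 + (size p1).+1) ++ rcons p1 (Jump b)
  end.

(** A common bound for the length of each straight-line block and for a comparison together with a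
    jump. Every elementary command and every test then counts as one unit. *)
Definition unit_cost : nat := (6 + 16 * K) * (2 * L + 2).

Definition rep (s : vstate) (f m : nat -> nat) : Prop :=
  [/\ all_words w f, all_words w m, vars s 0 = 0,
    forall x, mval w K f x.+2 = vars s x &
    forall p, address w m (iota (L * p) L) = cells s p].

(** A total-correctness triple with a cost [k] counted in multiples of [unit_cost], valid wherever
    the code is placed. Since it concerns one starting state, nested postconditions amount to
    symbolic execution. *)
Definition wp (c : cmd) (s : vstate) (k : nat) (Q : vstate -> Prop) : Prop :=
  forall P b f m, code_at P b (compile b c) -> rep s f m ->
  exists k' f' m' s', [/\
    exec w S P (State b f m) k' (State (b + size (compile b c)) f' m'),
    k' <= unit_cost * k, rep s' f' m' & Q s'].

Lemma wp_weaken c s k k' (Q Q' : vstate -> Prop) :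
  wp c s k Q -> k <= k' -> (forall s', Q s' -> Q' s') -> wp c s k' Q'.
Proof.
move=> H le QQ' P b f m Pc sR.
have [k1 [f' [m' [s' [e le1 s'R /QQ' q]]]]] := H P b f m Pc sR.
exists k1, f', m', s'; split=> //.
by apply: leq_trans le1 _; rewrite leq_mul2l le orbT.
Qed.

Lemma wp_straight c s k s' (Q : vstate -> Prop) :
  0 < k -> size (compile 0 c) <= unit_cost ->
  (forall b, compile b c = compile 0 c) ->
  (forall f m, rep s f m -> exists f' m', rep s' f' m' /\
    straight w S (compile 0 c) f m f' m') ->
  Q s' -> wp c s k Q.
Proof.
move=> k0 le cE H q P b f m; rewrite cE => Pc /H[f' [m' [s'R st]]].
exists (size (compile 0 c)), f', m', s'; split=> //; first exact: st.
by rewrite (leq_trans le)// leq_pmulr.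
Qed.

Lemma rep_set_var s x v f f' m :
  rep s f m -> all_words w f' -> x != 0 -> mval w K f' x.+2 = v ->
  (forall u, 1 < u -> u != x.+2 -> mval w K f' u = mval w K f u) ->
  rep (set_var s x v) f' m.
Proof.
move=> [wf wm s0 sv sm] wf' x0 f'x f'E; split=> //=.
  by rewrite eq_sym (negPf x0).
by move=> y; case: eqP => [->//|/eqP yx]; rewrite f'E ?sv.
Qed.

Lemma wp_add (i : bool) x y z s k (Q : vstate -> Prop) :
  0 < k -> x != 0 -> vars s y + vars s z + i < 2 ^ (w * K) ->
  Q (set_var s x (vars s y + vars s z + i)) -> wp (CAdd i x y z) s k Q.
Proof.
move=> k0 x0 lt_sum; apply: wp_straight => //.
  by rewrite (size_add_block K i x.+2 y.+2 z.+2) /unit_cost; nia.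
move=> f m sR; have [wf wm s0 sv sm] := sR; rewrite -!sv in lt_sum.
have [f' [st wf' f'x f'E]] := straight_add_var S w_gt0 x.+2 wf wm lt_sum.
exists f', m; split=> //; apply: rep_set_var sR _ _ _ _ => //.
  by rewrite f'x !sv.
by move=> u _; apply: f'E.
Qed.

Lemma wp_sub x y z s k (Q : vstate -> Prop) :
  0 < k -> x != 0 -> vars s z <= vars s y ->
  Q (set_var s x (vars s y - vars s z)) -> wp (CSub x y z) s k Q.
Proof.
move=> k0 x0 le; apply: wp_straight => //.
  by rewrite (size_sub_block K x.+2 y.+2 z.+2) /unit_cost; nia.
move=> f m sR; have [wf wm s0 sv sm] := sR; rewrite -!sv in le.
have [f' [st _ _ f'x f'E]] :=
  straight_sub_block S K w_gt0 x.+2 z.+2 wf wm (isT : y.+2 != 1).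
have [wf' _] := straight_words wf wm st.
exists f', m; split=> //; apply: rep_set_var sR _ _ _ _ => //.
  by rewrite f'x ?sv// -!sv.
by move=> u gtu ux; apply: f'E => //; case: u gtu {ux} => [|[]].
Qed.

Lemma size_addr_block y : size (addr_block K L y) = (3 + 15 * K) * L.+1.
Proof.
rewrite size_cat size_add_block mulnS; congr (_ + _).
elim: L => [|l IH]; first by rewrite muln0.
rewrite -[size _]/(size (add_block K false 0 0 y ++ scale_code K l y)).
by rewrite size_cat size_add_block IH mulnS.
Qed.

Lemma size_load_block x y :
  size (load_block K L x y) = (3 + 15 * K) * L.+1 + (4 + 15 * K) * L + (K - L).
Proof.
have size_read l r : size (read_code K l r) = (4 + 15 * K) * l.
  elim: l r => [|l IH] r; first by rewrite muln0.
  rewrite -[size _]/(size (add_block K true 0 0 2 ++ read_code K l r.+1)).+1.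
  by rewrite size_cat size_add_block IH mulnS; lia.
have size_zero l r : size (zero_code l r) = l by elim: l r => //= l IH r; rewrite IH.
by rewrite size_cat size_cat size_addr_block size_read size_zero addnA.
Qed.

Lemma size_store_block x y :
  size (store_block K L x y) = (3 + 15 * K) * L.+1 + (4 + 15 * K) * L.
Proof.
have size_write l r : size (write_code K l r) = (4 + 15 * K) * l.
  elim: l r => [|l IH] r; first by rewrite muln0.
  rewrite -[size _]/(size (add_block K true 0 0 2 ++ write_code K l r.+1)).+1.
  by rewrite size_cat size_add_block IH mulnS; lia.
by rewrite size_cat size_addr_block size_write.
Qed.

Lemma wp_load x y s k (Q : vstate -> Prop) :
  0 < k -> x != 0 -> L * (vars s y).+1 <= S ->
  Q (set_var s x (cells s (vars s y))) -> wp (CLoad x y) s k Q.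
Proof.
move=> k0 x0 le; apply: wp_straight => //.
  by rewrite (size_load_block x.+2 y.+2) /unit_cost; nia.
move=> f m sR; have [wf wm s0 sv sm] := sR; rewrite -!sv in le.
have f2 : mval w K f 2 = 0 by rewrite sv.
have gtx : 2 < x.+2 by case: x x0.
have [f' [st wf' f'x f'E]] :=
  straight_load_block w_gt0 S_lt le_LK wf wm f2 gtx (isT : y.+2 != 0) le.
exists f', m; split=> //; apply: rep_set_var sR _ _ _ _ => //.
  by rewrite f'x sm sv.
by move=> u gtu; apply: f'E; case: u gtu.
Qed.

Lemma wp_store x y s k (Q : vstate -> Prop) :
  0 < k -> L * (vars s x).+1 <= S -> vars s y < 2 ^ (w * L) ->
  Q (set_cell s (vars s x) (vars s y)) -> wp (CStore x y) s k Q.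
Proof.
move=> k0 le lty; apply: wp_straight => //.
  by rewrite (size_store_block x.+2 y.+2) /unit_cost; nia.
move=> f m sR; have [wf wm s0 sv sm] := sR; rewrite -!sv in le lty.
have f2 : mval w K f 2 = 0 by rewrite sv.
have [f' [m' [st [wf' wm'] m'x m'E f'E]]] := straight_store_block w_gt0 S_lt
  le_LK wf wm f2 (isT : x.+2 != 0) (isT : y.+2 != 0) le lty.
exists f', m'; split=> //; split=> // [u|p]; first by rewrite f'E.
rewrite /=; case: eqP => [->|/eqP px]; first by rewrite -sv m'x sv.
rewrite -sm; apply: eq_in_address => r; rewrite mem_iota => /andP[ler rlt].
apply: m'E; rewrite sv; move: px; rewrite neq_ltn => /orP[lt|gt].
  have := leq_mul (leqnn L) lt; rewrite mulnS; lia.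
have := leq_mul (leqnn L) gt; rewrite mulnS; lia.
Qed.

Lemma wp_skip s k (Q : vstate -> Prop) : Q s -> wp CSkip s k Q.
Proof.
move=> q P b f m _ sR; exists 0, f, m, s; split=> //.
by rewrite addn0; apply: exec0.
Qed.

Lemma wp_seq c1 c2 s k1 k2 k (Q : vstate -> Prop) :
  wp c1 s k1 (fun s' => wp c2 s' k2 Q) -> k1 + k2 <= k ->
  wp (CSeq c1 c2) s k Q.
Proof.
move=> H1 le P b f m /= /code_at_cat[Pc1 Pc2] sR.
have [k1' [f1 [m1 [s1 [e1 le1 s1R H2]]]]] := H1 P b f m Pc1 sR.
have [k2' [f2 [m2 [s2 [e2 le2 s2R q]]]]] := H2 P _ f1 m1 Pc2 s1R.
exists (k1' + k2'), f2, m2, s2; split=> //.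
  by rewrite size_cat addnA; apply: exec_trans e1 e2.
by apply: leq_trans (leq_add le1 le2) _; rewrite -mulnDr leq_mul2l le orbT.
Qed.

Lemma exec_jump P b l f m :
  onth P b = Some (Jump l) -> exec w S P (State b f m) 1 (State l f m).
Proof.
move=> Pb; have -> : State l f m = step w P (State b f m) by rewrite /= /fetch Pb.
by apply: exec1; rewrite /access_below /fetch Pb.
Qed.

Lemma size_lt_block x y l : size (lt_block x y l) = 5 + 16 * K.
Proof. by rewrite size_cat size_sub_block /= addn1. Qed.

Lemma size_lt_blocks cs l : size (lt_blocks cs l) = (5 + 16 * K) * size cs.
Proof.
elim: cs => [|xy cs IH]; first by rewrite muln0.
rewrite -[size _]/(size (lt_block xy.1 xy.2 l ++ lt_blocks cs l)).
by rewrite size_cat size_lt_block IH mulnS.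
Qed.

Lemma exec_lt_block P b x y l s f m :
  code_at P b (lt_block x y l) -> rep s f m ->
  exists f', rep s f' m /\
    exec w S P (State b f m) (5 + 16 * K)
      (State (if vars s x < vars s y then b + (5 + 16 * K) else l) f' m).
Proof.
move=> /code_at_cat[Pc /code_at_cons[Pj _]] [wf wm s0 sv sm].
have [f1 [st f10 f15 _ f1E]] :=
  straight_sub_block S K w_gt0 1 y.+2 wf wm (isT : x.+2 != 1).
have [wf1 _] := straight_words wf wm st.
exists f1; split.
  by split=> // u; rewrite f1E ?sv.
rewrite (_ : 5 + 16 * K = size (sub_block K 1 x.+2 y.+2) + 1); last first.
  by rewrite size_sub_block; lia.
apply: exec_trans (st _ _ Pc) _; set b1 := b + size _ in Pj *.
set s2 := State (if _ then _ else _) _ _.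
have -> : s2 = step w P (State b1 f1 m).
  rewrite /= /fetch /= Pj f10 f15 /s2 !sv addnA addn1 -/b1.
  by case: (ltnP (vars s x)).
by apply: exec1; rewrite /access_below /fetch /= Pj.
Qed.

Lemma exec_lt_blocks P b cs l s f m :
  code_at P b (lt_blocks cs l) -> rep s f m ->
  exists k f', [/\ rep s f' m, k <= (5 + 16 * K) * size cs &
    exec w S P (State b f m) k
      (State (if all (lt_vars s) cs then b + (5 + 16 * K) * size cs else l)
         f' m)].
Proof.
elim: cs b f => [|[x y] cs IH] b f.
  by move=> _ sR; exists 0, f; split=> //=; rewrite muln0 addn0; apply: exec0.
move=> /code_at_cat[Pc Pcs] sR.
have [f1 [s1R e1]] := exec_lt_block Pc sR.
have -> : all (lt_vars s) ((x, y) :: cs) =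
  (vars s x < vars s y) && all (lt_vars s) cs by [].
rewrite [size (_ :: _)]/=; move: e1; case: ltnP => _ e1; last first.
  by exists (5 + 16 * K), f1; split=> //; rewrite mulnS leq_addr.
rewrite size_lt_block in Pcs.
have [k [f2 [s2R le2 e2]]] := IH _ _ Pcs s1R.
exists (5 + 16 * K + k), f2; split=> //; first by rewrite mulnS leq_add2l.
by rewrite mulnS addnA; apply: exec_trans e1 e2.
Qed.

Lemma wp_if x y c1 c2 s k (Q : vstate -> Prop) :
  (if vars s x < vars s y then wp c1 s k Q else wp c2 s k Q) ->
  wp (CIf x y c1 c2) s k.+1 Q.
Proof.
move=> H P b f m; pose b1 := b + (5 + 16 * K); pose p1 := compile b1 c1.
pose b2 := b1 + (size p1).+1; pose p2 := compile b2 c2.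
rewrite -[compile b _]/(lt_block x y b2 ++ p1 ++ Jump (b2 + size p2) :: p2).
move=> /code_at_cat[Pl]; rewrite size_lt_block -/b1.
move=> /code_at_cat[Pc1 /code_at_cons[Pj Pc2]] sR.
have [f1 [s1R e1]] := exec_lt_block Pl sR.
have -> : b + size (lt_block x y b2 ++ p1 ++ Jump (b2 + size p2) :: p2) =
    b2 + size p2.
  by rewrite size_cat size_lt_block size_cat /= /b2 /b1; lia.
have le_unit : 6 + 16 * K <= unit_cost by rewrite /unit_cost; nia.
have b2E : (b1 + size p1).+1 = b2 by rewrite /b2 addnS.
move: H e1; case: ltnP => _ H e1.
  have [k1 [f2 [m2 [s2 [e2 le2 s2R q]]]]] := H P b1 f1 m Pc1 s1R.
  exists (5 + 16 * K + (k1 + 1)), f2, m2, s2; split=> //; last first.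
    by rewrite mulnS; lia.
  by apply: exec_trans e1 (exec_trans e2 _); apply: exec_jump.
rewrite b2E in Pc2.
have [k1 [f2 [m2 [s2 [e2 le2 s2R q]]]]] := H P b2 f1 m Pc2 s1R.
exists (5 + 16 * K + k1), f2, m2, s2; split=> //; last by rewrite mulnS; lia.
exact: exec_trans e1 e2.
Qed.

(* The measure [mu] bounds the cost of the remaining iterations. *)
Lemma wp_while (I : vstate -> Prop) (mu : vstate -> nat) cs c s k
    (Q : vstate -> Prop) :
  I s -> mu s + (size cs).+1 <= k ->
  (forall s1, I s1 -> all (lt_vars s1) cs ->
    exists kb, wp c s1 kb (fun s2 => I s2 /\ kb + (size cs).+1 + mu s2 <= mu s1)) ->
  (forall s1, I s1 -> ~~ all (lt_vars s1) cs -> Q s1) ->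
  wp (CWhile cs c) s k Q.
Proof.
move=> Is lek Ibody Iexit; apply: wp_weaken lek (fun _ => id).
(* Every iteration lowers [mu] by at least [(size cs).+1], so induction on a bound for [mu] yields
   termination together with the cost. *)
have [n] := ubnP (mu s); elim: n s Is => // n IH s Is ltn P b f m Pw sR.
pose b1 := b + (5 + 16 * K) * size cs; pose p1 := compile b1 c.
pose l := b1 + (size p1).+1.
have cE : compile b (CWhile cs c) = lt_blocks cs l ++ p1 ++ [:: Jump b].
  by rewrite cats1.
have := Pw; rewrite cE => /code_at_cat[Pl]; rewrite size_lt_blocks -/b1.
move=> /code_at_cat[Pc /code_at_cons[Pj _]].
have [k1 [f1 [s1R le1 e1]]] := exec_lt_blocks Pl sR.
have lE : b + size (lt_blocks cs l ++ p1 ++ [:: Jump b]) = l.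
  by rewrite size_cat size_lt_blocks size_cat /= /l /b1; lia.
rewrite lE.
(* The conjunction may fail early, so [k1] is only bounded above; the extra 1 pays for the jump
   back. *)
have le_test : k1 + 1 <= unit_cost * (size cs).+1.
  rewrite /unit_cost; nia.
have [allc|nallc] := boolP (all (lt_vars s) cs); last first.
  exists k1, f1, m, s; split=> //; last exact: Iexit.
    by move: e1; rewrite (negPf nallc).
  by rewrite mulnDr; lia.
rewrite allc -/b1 in e1.
have [kb H] := Ibody s Is allc.
have [k2 [f2 [m2 [s2 [e2 le2 s2R [Is2 dec]]]]]] := H P b1 f1 m Pc s1R.
have [|k3 [f3 [m3 [s3 [e3 le3 s3R q]]]]] := IH s2 Is2 _ P b f2 m2 Pw s2R.
  by lia.
exists (k1 + (k2 + (1 + k3))), f3, m3, s3; split=> //.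
  apply: exec_trans e1 (exec_trans e2 (exec_trans (exec_jump f2 m2 Pj) _)).
  by rewrite cE lE in e3.
have := leq_mul (leqnn unit_cost) dec; rewrite mulnDr in le3 *.
by rewrite !mulnDr; lia.
Qed.

(** The offset [6 + 16 * K] skips the comparison and [Halt false], so a failing test [x < y] ends in
    [Halt true]. *)
Definition test_program (c : cmd) (x y : nat) : program :=
  let p := compile 0 c in
  p ++ lt_block x y (size p + (6 + 16 * K)) ++ [:: Halt false; Halt true].

Lemma wp_halts_within c x y s k (Q : vstate -> Prop) f m :
  wp c s k Q -> rep s f m ->
  exists2 s', Q s' & halts_within w (test_program c x y) (State 0 f m)
    (vars s' y <= vars s' x) (unit_cost * k + (6 + 16 * K)) S.
Proof.
move=> H sR; pose p := compile 0 c; pose P := test_program c x y.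
have /code_at_cat[Pc /code_at_cat[Pl]] : code_at P 0 P := @code_at_refl P.
rewrite add0n size_lt_block => /code_at_cons[Pf /code_at_cons[Pt _]].
have [k1 [f1 [m1 [s1 [e1 le1 s1R q]]]]] := H P 0 f m Pc sR.
have [f2 [s2R e2]] := exec_lt_block Pl s1R.
have [e12 acc] := exec_trans e1 e2.
exists s1 => //; exists (k1 + (5 + 16 * K)); split=> //; first by lia.
rewrite e12 /fetch [_ <= vars s1 x]leqNgt add0n -/P.
by case: (_ < _); [exact: Pf | move: Pt; rewrite -addnS].
Qed.

End Compiler.

Lemma halts_within_weaken w P s v T S T' S' :
  T <= T' -> S <= S' -> halts_within w P s v T S -> halts_within w P s v T' S'.
Proof.
move=> leT leS [k [ltk Pk acc]]; exists k; split=> //; first exact: leq_trans leT.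
move=> i /acc; rewrite /access_below; case: fetch => // -[] // *;
  exact: leq_trans leS.
Qed.

(** * The conjugacy test *)

Definition seqc (cs : seq cmd) : cmd := foldr CSeq CSkip cs.

Arguments seqc : simpl never.

(* Variables below 10 are written by [setup] only. *)
Definition zero := 0.
Definition vn := 1.
Definition vd := 2.
Definition one := 3.
Definition vA := 4.
Definition vB := 5.
Definition vPos := 6.
Definition vU := 7.
Definition vN := 8.
Definition vV := 9.
Definition vk := 10.
Definition vt := 11.
Definition va := 12.
Definition vb := 13.
Definition vx := 14.
Definition vy := 15.
Definition vr := 16.
Definition vbase := 17.
Definition vstep := 18.
Definition vq := 19.
Definition vz := 20.
Definition vi := 21.
Definition vv := 22.
Definition vj := 23.
Definition vm := 24.
Definition vu := 25.

Definition set0 x := CAdd false x zero zero.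
Definition copy x y := CAdd false x y zero.
Definition incr x := CAdd true x x zero.
Definition plus x y z := CAdd false x y z.

(** The product [d * n] is accumulated in [vm] by [d] additions. Memory layout: [n], [d], the tables
    of the two tuples at [vA] and [vB], a table of [n] positions at [vPos], then the two words of
    length [vN] at [vU] and [vV]. *)
Definition setup : cmd := seqc [::
  CLoad vn zero; CAdd true one zero zero; CLoad vd one; CAdd true vA one zero;
  set0 vm; set0 vk;
  CWhile [:: (vk, vd)] (seqc [:: plus vm vm vn; incr vk]);
  plus vB vA vm; plus vPos vB vm; plus vU vPos vn; plus vN vm vn;
  plus vV vU vN].

(** When it stops, [vt] is the smaller of the two return times of 0. Both are at most [n], so [vt]
    equals [n] exactly when both permutations are [n]-cycles. *)
Definition walk : cmd :=
  CWhile [:: (zero, vx); (zero, vy)] (seqc [::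
    plus vr va vx; CLoad vx vr; plus vr vb vy; CLoad vy vr; incr vt]).

(** The initial value 0 of [vt] forces a first pass. The pointers are advanced even after a
    successful pair, which the two final subtractions undo. *)
Definition find_cycle : cmd := seqc [::
  copy va vA; copy vb vB; set0 vt;
  CWhile [:: (vt, vn)] (seqc [::
    CLoad vx va; CLoad vy vb; copy vt one; walk;
    plus va va vn; plus vb vb vn]);
  CSub va va vn; CSub vb vb vn].

Definition build_pos : cmd := seqc [::
  set0 vz; set0 vi;
  CWhile [:: (vi, vn)] (seqc [::
    plus vr vPos vz; CStore vr vi; plus vr vstep vz; CLoad vz vr; incr vi])].

Definition build_block : cmd :=
  CWhile [:: (vk, vd)] (seqc [::
    CLoad vv vr; plus vv vPos vv; CLoad vv vv;
    CIf vv vi (plus vv vv vn) CSkip;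
    CSub vv vv vi; CStore vq vv; incr vq; plus vr vr vn; incr vk]).

Definition build_letters : cmd := seqc [::
  set0 vz; set0 vi;
  CWhile [:: (vi, vn)] (seqc [::
    CStore vq vn; incr vq; plus vr vbase vz; set0 vk; build_block;
    plus vr vstep vz; CLoad vz vr; incr vi])].

(** Inside the loop [start] and [vt] are below [vN], so one conditional subtraction reduces their
    sum modulo [vN]. *)
Definition fetch_letter dst word start : cmd := seqc [::
  plus vr start vt; CIf vr vN CSkip (CSub vr vr vN);
  plus vr word vr; CLoad dst vr].

Definition compare : cmd := seqc [::
  set0 vi; set0 vj; set0 vt;
  CWhile [:: (vi, vN); (vj, vN); (vt, vN)] (seqc [::
    fetch_letter vu vU vi; fetch_letter vv vV vj;
    CIf vu vv (seqc [:: CAdd true vj vj vt; set0 vt])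
      (CIf vv vu (seqc [:: CAdd true vi vi vt; set0 vt]) (incr vt))])].

Definition conj_test : cmd := seqc [::
  setup; find_cycle;
  copy vq vU;
  copy vbase vA; copy vstep va; build_pos; build_letters;
  copy vbase vB; copy vstep vb; build_pos; build_letters;
  compare].

(** Only the orbit of 0 is constrained. Together with [f_lt] and [f_return] below, this makes [f] an
    [n]-cycle on the numbers below [n]. *)
Definition full_cycle (n : nat) (f : nat -> nat) : Prop :=
  forall m, 0 < m < n -> iter m f 0 != 0.

(** For [v, i < n] this is the residue of [v - i] modulo [n], in the form in which the program
    computes it. *)
Definition cyclic_sub (n v i : nat) : nat := (if v < i then v + n else v) - i.

Definition letter (n d : nat) (F : nat -> nat -> nat) (j p : nat) : nat :=
  let i := p %/ d.+1 in
  if p %% d.+1 is k.+1 then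
    cyclic_sub n (index (F k (iter i (F j) 0)) (traject (F j) 0 n)) i
  else n.

Definition rotation_of (N : nat) (U V : nat -> nat) : Prop :=
  exists2 s, s < N & forall m, m < N -> U m = V ((m + s) %% N).

(** * Maps whose orbit of 0 has length [n] *)

Section FullCycle.

Variables (n : nat) (f : nat -> nat).
Hypotheses (f_lt : forall z, z < n -> f z < n) (n_gt0 : 0 < n).
Hypotheses (f_full : full_cycle n f)
  (f_return : exists2 m, 0 < m <= n & iter m f 0 = 0).

Lemma iter_lt i : iter i f 0 < n.
Proof. by elim: i => //= i; apply: f_lt. Qed.

Lemma full_cycle_return : iter n f 0 = 0.
Proof.
have [m mP m0] := f_return; have [<-//|neq_mn] := eqVneq m n.
have mn : 0 < m < n by lia.
by have := f_full mn; rewrite m0 eqxx.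
Qed.

(** If the iterates [m < i] agreed, [n - i] further steps would bring 0 back after [n - i + m]
    steps, which is positive and less than [n]. *)
Lemma full_cycle_inj m i : m < i < n -> iter m f 0 != iter i f 0.
Proof.
move=> /andP[lt_mi lt_in]; apply/eqP => eq_mi.
have : iter (n - i + m) f 0 != 0 by apply: f_full; lia.
by rewrite iterD eq_mi -iterD subnK ?full_cycle_return ?eqxx// ltnW.
Qed.

Lemma full_cycle_uniq : uniq (traject f 0 n).
Proof.
apply/(uniqP 0) => i j; rewrite !inE size_traject => lti ltj.
rewrite !nth_traject// => eq_ij.
case: (ltngtP i j) => // lt.
  by have /eqP[] := full_cycle_inj (introT andP (conj lt ltj)).
by have /eqP[] := full_cycle_inj (introT andP (conj lt lti)).
Qed.

(** Pigeonhole: [n] distinct values below [n] exhaust them. *)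
Lemma full_cycle_mem z : z < n -> z \in traject f 0 n.
Proof.
move=> ltz; have sub : {subset traject f 0 n <= iota 0 n}.
  by move=> _ /trajectP[i _ ->]; rewrite mem_iota iter_lt.
have [|_ eq_mem] := uniq_min_size full_cycle_uniq sub.
  by apply: eq_leq; rewrite (size_iota 0 n) (size_traject f 0 n).
by rewrite eq_mem mem_iota.
Qed.

Lemma full_cycle_index z : z < n ->
  index z (traject f 0 n) < n /\ iter (index z (traject f 0 n)) f 0 = z.
Proof.
move=> /full_cycle_mem zin.
have lt : index z (traject f 0 n) < n by rewrite -{2}(size_traject f 0 n) index_mem.
by split=> //; rewrite -(nth_traject f lt 0) nth_index.
Qed.

Lemma full_cycle_index_iter i : i < n -> index (iter i f 0) (traject f 0 n) = i.
Proof.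
move=> lti; rewrite -(nth_traject f lti 0) index_uniq ?size_traject//.
exact: full_cycle_uniq.
Qed.

End FullCycle.

(** * Least rotations and skipped starting points *)

Section Rotations.

Variable N : nat.

Definition rot_from (U : nat -> nat) (i m : nat) : nat := U ((i + m) %% N).

Definition lex_lt (f g : nat -> nat) : bool :=
  [exists t : 'I_N, (f t < g t) && [forall m : 'I_N, (m < t) ==> (f m == g m)]].

Lemma lex_ltP f g :
  reflect (exists2 t, t < N & f t < g t /\ forall m, m < t -> f m = g m)
          (lex_lt f g).
Proof.
apply: (iffP existsP) => [[t /andP[lt /forallP eq]]|[t ltt [lt eq]]].
  exists t => //; split=> // m ltm.
  by have /implyP/(_ ltm)/eqP := eq (Ordinal (ltn_trans ltm (ltn_ord t))).
exists (Ordinal ltt); rewrite lt; apply/forallP => m.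
by apply/implyP => /eq/eqP.
Qed.

Lemma lex_lt_irr f : lex_lt f f = false.
Proof. by apply/lex_ltP => -[t _ []]; rewrite ltnn. Qed.

Lemma lex_lt_trans g f h : lex_lt f g -> lex_lt g h -> lex_lt f h.
Proof.
move=> /lex_ltP[t ltt [fg eq_fg]] /lex_ltP[u ltu [gh eq_gh]]; apply/lex_ltP.
have [lt_tu|lt_ut|eq_tu] := ltngtP t u.
- exists t => //; split=> [|m ltm]; first by rewrite -eq_gh.
  by rewrite eq_fg// eq_gh// (ltn_trans ltm).
- exists u => //; split=> [|m ltm]; first by rewrite eq_fg.
  by rewrite eq_fg ?eq_gh// (ltn_trans ltm).
- exists t => //; split=> [|m ltm]; first by rewrite (ltn_trans fg)// eq_tu.
  by rewrite eq_fg ?eq_gh// -eq_tu.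
Qed.

Lemma eq_lex_lt f f' g g' : f =1 f' -> g =1 g' -> lex_lt f g = lex_lt f' g'.
Proof.
move=> ef eg; apply/lex_ltP/lex_ltP => -[t ltt [lt eq]]; exists t => //.
  by split=> [|m ltm]; rewrite -ef -eg// eq.
by split=> [|m ltm]; rewrite ef eg// eq.
Qed.

Lemma exists_minimal (r : rel nat) k : 0 < k -> irreflexive r -> transitive r ->
  exists2 i, i < k & forall j, j < k -> ~~ r j i.
Proof.
move=> + irr trans; elim: k => // -[_ _|k /(_ isT)[i lti min] _].
  by exists 0 => // -[|j]//; rewrite irr.
have [rki|nrki] := boolP (r k.+1 i); last first.
  exists i => [|j]; first exact: ltnW.
  by rewrite ltnS leq_eqVlt => /orP[/eqP->|/min].
exists k.+1 => // j; rewrite ltnS leq_eqVlt => /orP[/eqP->|/min]; first by rewrite irr.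
by apply: contra => rjk; apply: trans rki.
Qed.

(** The loop invariant of a candidate: each start before [i] was discarded because some rotation of
    the other word is strictly smaller. *)
Definition dominated (U V : nat -> nat) (i : nat) : Prop :=
  forall i', i' < i -> exists j, lex_lt (rot_from V j) (rot_from U i').

(** For [e <= t], the rotation of [V] from [j + e] and that of [U] from [i + e] agree on [t - e]
    letters, and then [U] has the smaller letter. This discards all of [j, ..., j + t] at once. *)
Lemma dominated_mismatch U V i j t :
  t < N -> (forall m, m < t -> rot_from U i m = rot_from V j m) ->
  rot_from U i t < rot_from V j t ->
  dominated V U j -> dominated V U (j + t).+1.
Proof.
move=> ltt eq lt dom j'; rewrite ltnS => lej'.
have [/dom//|le_jj'] := ltnP j' j.
exists (i + (j' - j)); apply/lex_ltP; exists (t - (j' - j)); first by lia.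
have shift W k m : rot_from W (k + (j' - j)) m = rot_from W k (j' - j + m).
  by rewrite /rot_from addnA.
have rotV m : rot_from V j' m = rot_from V j (j' - j + m).
  by rewrite -{1}(subnKC le_jj') shift.
split=> [|m ltm]; rewrite shift rotV.
  by rewrite subnKC//; lia.
by apply: eq; lia.
Qed.

Lemma rotation_of_sym U V : rotation_of N U V -> rotation_of N V U.
Proof.
move=> [s lts UV]; exists ((N - s) %% N) => [|m ltm].
  by rewrite ltn_pmod//; apply: leq_ltn_trans lts.
have N_gt0 : 0 < N by apply: leq_ltn_trans lts.
rewrite UV ?ltn_pmod//; congr V.
rewrite modnDmr modnDml -addnA subnK ?(ltnW lts)//.
by rewrite modnDr modn_small.
Qed.

(** Every rotation of [V] is one of [U], so a start of [U] below [N] with least rotation is beaten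
    by none. If [N <= i], that start would be among the dominated ones. *)
Lemma rotation_not_dominated U V i :
  0 < N -> rotation_of N U V -> dominated U V i -> i < N.
Proof.
move=> N_gt0 UV dom; rewrite ltnNge; apply/negP => leNi.
have [s lts VU] := rotation_of_sym UV.
have rotV j : rot_from V j =1 rot_from U ((j + s) %% N).
  move=> m; rewrite /rot_from VU ?ltn_pmod// modnDml modnDml.
  by congr (U (_ %% _)); lia.
have [||i' lti' min] :=
  @exists_minimal (fun j i => lex_lt (rot_from U j) (rot_from U i)) N N_gt0.
- by move=> j; apply: lex_lt_irr.
- by move=> g f h; apply: lex_lt_trans.
have [j] := dom i' (leq_trans lti' leNi).
rewrite (eq_lex_lt (rotV j) (fun=> erefl)); apply/negP/min.
exact: ltn_pmod.
Qed.

Lemma rot_from_rotation U V i j : 0 < N ->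
  (forall m, m < N -> rot_from U i m = rot_from V j m) -> rotation_of N U V.
Proof.
move=> N_gt0 eq; exists ((j + (N - i %% N)) %% N) => [|m ltm].
  exact: ltn_pmod.
have lti : i %% N < N by apply: ltn_pmod.
have := eq ((m + (N - i %% N)) %% N) (ltn_pmod _ N_gt0).
rewrite /rot_from !modnDmr => eq_m.
have im : (i + (m + (N - i %% N))) %% N = m.
  rewrite -modnDml addnCA subnKC ?(ltnW lti)// modnDr modn_small//.
by rewrite im in eq_m; rewrite eq_m; congr V; congr (_ %% _); lia.
Qed.

End Rotations.

(** * Correctness and cost of the test *)

Section Program.

Variables (w S K L : nat).
Hypotheses (w_gt0 : 0 < w) (S_lt : S < 2 ^ (w * K)) (le_LK : L <= K).

Local Notation wp := (wp w S K L).

Lemma wp_nil s k (Q : vstate -> Prop) : Q s -> wp (seqc [::]) s k Q.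
Proof. exact: wp_skip. Qed.

Lemma wp_cons c cs s k1 k2 k (Q : vstate -> Prop) :
  k1 + k2 = k -> wp c s k1 (fun s' => wp (seqc cs) s' k2 Q) ->
  wp (seqc (c :: cs)) s k Q.
Proof. by move=> <- H; apply: wp_seq H (leqnn _). Qed.

Lemma wp_step c cs s k (Q : vstate -> Prop) :
  wp c s 1 (fun s' => wp (seqc cs) s' k Q) -> wp (seqc (c :: cs)) s k.+1 Q.
Proof. exact: wp_cons. Qed.

Variables (n d : nat) (A B : nat -> nat -> nat) (inp : nat -> nat).
Hypotheses (n_gt0 : 0 < n) (d_gt0 : 0 < d).
Hypotheses (L_gt0 : 0 < L) (n_lt : n < 2 ^ (w * L)).

Local Notation size_mem := (2 + 4 * (d * n) + 3 * n).
Hypothesis mem_le : L * size_mem <= S.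

Hypotheses (inp0 : inp 0 = n) (inp1 : inp 1 = d).
Hypothesis inpA : forall k z, k < d -> z < n -> inp (2 + (k * n + z)) = A k z.
Hypothesis inpB : forall k z, k < d -> z < n ->
  inp (2 + d * n + (k * n + z)) = B k z.
Hypothesis A_lt : forall k z, k < d -> z < n -> A k z < n.
Hypothesis B_lt : forall k z, k < d -> z < n -> B k z < n.

Lemma index_lt k z : k < d -> z < n -> k * n + z < d * n.
Proof.
move=> ltk ltz; apply: (@leq_trans (k.+1 * n)); last by rewrite leq_mul2r ltk orbT.
by rewrite mulSn addnC ltn_add2r.
Qed.

Lemma small v : v <= size_mem -> v < 2 ^ (w * K).
Proof.
by move=> le; apply: leq_ltn_trans S_lt; apply: leq_trans mem_le; nia.
Qed.

Lemma cell_ok p : p < size_mem -> L * p.+1 <= S.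
Proof. by move=> lt; apply: leq_trans mem_le; rewrite leq_mul2l lt orbT. Qed.

Definition constants : seq nat :=
  [:: 0; n; d; 1; 2; 2 + d * n; 2 + 2 * (d * n); 2 + 2 * (d * n) + n; d * n + n;
      2 + 3 * (d * n) + 2 * n].

Definition env (s : vstate) : Prop :=
  (forall x, x < 10 -> vars s x = nth 0 constants x) /\
  (forall p, p < 2 + 2 * (d * n) -> cells s p = inp p).

Lemma env_set s x v : env s -> 9 < x -> env (set_var s x v).
Proof.
move=> [ev ec] gtx; split=> // y lty /=.
by rewrite (ltn_eqF (leq_trans lty gtx)) ev.
Qed.

Lemma env_cell s p v : env s -> 2 + 2 * (d * n) <= p -> env (set_cell s p v).
Proof.
move=> [ev ec] le; split=> // q ltq /=.
by rewrite (ltn_eqF (leq_trans ltq le)) ec.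
Qed.

Lemma env_vars s : env s ->
  ((vars s zero = 0)%N * (vars s vn = n) * (vars s vd = d)
   * (vars s one = 1)%N * (vars s vA = 2)%N * (vars s vB = 2 + d * n)%N
   * (vars s vPos = 2 + 2 * (d * n))%N * (vars s vU = 2 + 2 * (d * n) + n)%N
   * (vars s vN = d * n + n)%N * (vars s vV = 2 + 3 * (d * n) + 2 * n)%N)%type.
Proof. by move=> [ev _]; rewrite !ev. Qed.

Ltac wstep := apply: wp_step.

(** A round of the loop costs 2 for its body and 2 for the test and the jump back, whence [4 * d].
    The later bounds follow the same accounting: one unit per elementary command or conditional, and
    [(size cs).+1] per evaluation of a loop guard. *)
Lemma wp_setup s :
  vars s 0 = 0 -> cells s =1 inp -> wp setup s (4 * d + 13) env.
Proof.
move=> s0 sc; rewrite /setup.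
have lt1 : 1 < 2 ^ (w * K) by apply: small; lia.
have lt2 : 2 < 2 ^ (w * K) by apply: small; lia.
have lt0 : 0 < 2 ^ (w * K) by apply: ltnW.
have dn_gt0 : 0 < d * n by rewrite muln_gt0 d_gt0.
rewrite (_ : 4 * d + 13 = (4 * d + 2 + 5).+2.+4); last by lia.
wstep; apply: wp_load => //; first by rewrite s0; apply: cell_ok; lia.
rewrite s0 sc inp0.
wstep; apply: wp_add => //=; first by rewrite s0.
rewrite s0.
wstep; apply: wp_load => //=; first by apply: cell_ok; lia.
rewrite sc inp1.
wstep; apply: wp_add => //=; first by rewrite s0.
wstep; apply: wp_add => //=; first by rewrite s0.
wstep; apply: wp_add => //=; first by rewrite s0.
rewrite s0; set s1 := set_var _ vk _.
apply: wp_cons (erefl _) _.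
pose I s := exists2 k, k <= d & [/\ forall x, x < 5 -> vars s x = nth 0 constants x,
  vars s vk = k, vars s vm = k * n & cells s =1 inp].
apply: (wp_while w_gt0 S_lt le_LK (I := I) (mu := fun s => 4 * (d - vars s vk))).
- by exists 0 => //; split=> //= [[|[|[|[|[|]]]]]] //=; rewrite s0.
- by rewrite /= subn0.
- move=> s2 [k ledk [s2v s2k s2m s2c]]; rewrite /= andbT /lt_vars /= s2k (s2v 2)//=.
  move=> ltk; exists 2.
  have le_dn : k.+1 * n <= d * n by rewrite leq_mul2r ltk orbT.
  wstep; apply: wp_add => //=; first by rewrite s2m !s2v//=; apply: small; lia.
  wstep; apply: wp_add => //=; first by rewrite s2k s2v//=; apply: small; nia.
  apply: wp_nil; split; last by rewrite /= s2k s2v//= ; lia.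
  exists k.+1 => //; split=> //=.
  + by move=> [|[|[|[|[|]]]]] // _ /=; rewrite s2v.
  + by rewrite s2k s2v//=; lia.
  + by rewrite s2m !s2v//=; lia.
- move=> s2 [k ledk [s2v s2k s2m s2c]].
  rewrite /= andbT /lt_vars /= s2k (s2v 2)//= -leqNgt => lekd.
  have {lekd ledk} kd : k = d by apply/eqP; rewrite eqn_leq ledk.
  rewrite {k}kd in s2k s2m.
  wstep; apply: wp_add => //=; first by rewrite s2m !s2v//=; apply: small; lia.
  rewrite s2m !s2v//=.
  wstep; apply: wp_add => //=; first by rewrite s2m; apply: small; lia.
  rewrite s2m.
  wstep; apply: wp_add => //=; first by rewrite !s2v//=; apply: small; lia.
  rewrite s2v//=.
  wstep; apply: wp_add => //=; first by rewrite s2m !s2v//=; apply: small; lia.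
  rewrite s2m s2v//=.
  wstep; apply: wp_add => //=; first by apply: small; lia.
  apply: wp_nil; split=> [x|p _] /=; last exact: s2c.
  do 10 (case: x => [|x] /=; first by rewrite ?s2v//=; lia).
  by [].
Qed.

Definition walk_inv (k t : nat) : Prop :=
  forall m, 0 < m < t -> iter m (A k) 0 != 0 /\ iter m (B k) 0 != 0.

Hypothesis A_return : forall k, k < d -> exists2 m, 0 < m <= n & iter m (A k) 0 = 0.

Lemma A_iter_lt k i : k < d -> iter i (A k) 0 < n.
Proof. by move=> ltk; elim: i => //= i IH; apply: A_lt. Qed.

Lemma B_iter_lt k i : k < d -> iter i (B k) 0 < n.
Proof. by move=> ltk; elim: i => //= i IH; apply: B_lt. Qed.

Definition at_index (s : vstate) (k : nat) : Prop :=
  vars s va = 2 + k * n /\ vars s vb = 2 + d * n + k * n.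

Lemma wp_walk s k :
  env s -> k < d -> at_index s k ->
  vars s vt = 1 -> vars s vx = A k 0 -> vars s vy = B k 0 ->
  wp walk s (8 * n + 3) (fun s' => [/\ env s', at_index s' k,
    walk_inv k (vars s' vt), 0 < vars s' vt <= n &
    (n <= vars s' vt) || (iter (vars s' vt) (A k) 0 == 0) ||
      (iter (vars s' vt) (B k) 0 == 0)]).
Proof.
move=> es ltk [sa sb] st sx sy.
pose I s := exists2 t, 0 < t <= n & [/\ env s, at_index s k,
  vars s vt = t /\ walk_inv k t,
  vars s vx = iter t (A k) 0 & vars s vy = iter t (B k) 0].
apply: (wp_while w_gt0 S_lt le_LK (I := I) (mu := fun s => 8 * (n - vars s vt))).
- by exists 1 => //; split=> //; split=> // m; lia.
- by rewrite /= st; lia.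
- move=> s1 [t ltt [es1 [s1a s1b] [s1t wi] s1x s1y]].
  rewrite /= /lt_vars /= !(env_vars es1) s1x s1y andbT => /andP[x0 y0].
  (* The walk cannot pass [n]: [A k] brings 0 back within [n] steps, while the invariant and the
     nonzero [vx] exclude a return at any time from 1 to [t]. *)
  have lt_tn : t < n.
    have [m mP m0] := A_return ltk; rewrite ltnNge; apply/negP => le_nt.
    have [eq_mt|neq_mt] := eqVneq m t; first by rewrite -eq_mt m0 in x0.
    by have [|/eqP] := wi m; first by lia.
  exists 5; have ltA := A_iter_lt t ltk; have ltB := B_iter_lt t ltk.
  have iA := index_lt ltk ltA; have iB := index_lt ltk ltB.
  wstep; apply: wp_add => //=; first by rewrite s1a s1x; apply: small; lia.
  rewrite s1a s1x.
  wstep; apply: wp_load => //=; first by apply: cell_ok; lia.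
  have [_ ->] := es1; last by lia.
  rewrite addn0 -addnA inpA//.
  wstep; apply: wp_add => //=; first by rewrite s1b s1y; apply: small; lia.
  rewrite s1b s1y.
  wstep; apply: wp_load => //=; first by apply: cell_ok; lia.
  have [_ ->] := es1; last by lia.
  rewrite addn0 -addnA inpB//.
  wstep; apply: wp_add => //=; first by rewrite s1t !(env_vars es1); apply: small; lia.
  rewrite s1t !(env_vars es1) addn0 addn1.
  apply: wp_nil; split; last by rewrite /=; lia.
  exists t.+1 => //; split=> //=; first by do 5 apply: env_set => //.
  split=> // m mP; have [->|neq_mt] := eqVneq m t; last by apply: wi; lia.
  by rewrite -!lt0n.
- move=> s1 [t ltt [es1 [s1a s1b] [s1t wi] s1x s1y]].
  rewrite /= /lt_vars /= !(env_vars es1) s1x s1y andbT negb_and -!eqn0Ngt.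
  by rewrite -s1t in ltt wi * => H; split=> //; rewrite -orbA H orbT.
Qed.

Hypothesis full_exists :
  exists2 k, k < d & full_cycle n (A k) /\ full_cycle n (B k).

Lemma wp_find_cycle s :
  env s -> wp find_cycle s (d * (8 * n + 10) + 7) (fun s' => env s' /\
    exists2 k, k < d & [/\ at_index s' k, full_cycle n (A k) & full_cycle n (B k)]).
Proof.
move=> es; have dn_gt0 : 0 < d * n by rewrite muln_gt0 d_gt0.
rewrite (_ : d * _ + 7 = (d * (8 * n + 10) + 2 + 2).+3); last by lia.
wstep; apply: wp_add => //=; first by rewrite !(env_vars es); apply: small; lia.
rewrite !(env_vars es).
wstep; apply: wp_add => //=; first by rewrite !(env_vars es); apply: small; lia.
rewrite !(env_vars es).
wstep; apply: wp_add => //=; first by rewrite !(env_vars es); apply: small; lia.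
rewrite !(env_vars es) !addn0.
apply: wp_cons (erefl _) _.
pose both k := full_cycle n (A k) /\ full_cycle n (B k).
pose I s := exists2 k, k <= d & [/\ env s, at_index s k,
  vars s vt < n -> forall k', k' < k -> ~ both k' &
  n <= vars s vt -> 0 < k /\ both k.-1].
(* The number of pairs already examined is recovered from the pointer [va = 2 + k * n]; no variable
   counts them. *)
pose count s := d - (vars s va - 2) %/ n.
apply: (wp_while w_gt0 S_lt le_LK (I := I) (mu := fun s => count s * (8 * n + 10))).
- exists 0 => //; split=> //=; last by lia.
  + by do 3 apply: env_set => //.
  + by split=> /=; lia.
- by rewrite /= leq_add2r leq_mul2r /count leq_subr orbT.
- move=> s1 [k lek [es1 [s1a s1b] none _]].
  rewrite /= /lt_vars /= !(env_vars es1) andbT => lt_tn.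
  (* If all pairs had been rejected, the promised index would be among them. *)
  have ltk : k < d.
    rewrite ltnNge; apply/negP => ledk.
    have [k0 ltk0 both0] := full_exists.
    exact: none lt_tn k0 (leq_trans ltk0 ledk) both0.
  have i0 := index_lt ltk n_gt0.
  exists (8 * n + 8).
  rewrite (_ : 8 * n + 8 = (8 * n + 3 + 2).+3); last by lia.
  wstep; apply: wp_load => //=; first by rewrite s1a; apply: cell_ok; lia.
  rewrite s1a; have [_ ->] := es1; last by lia.
  rewrite -[k * n]addn0 inpA//.
  wstep; apply: wp_load => //=; first by rewrite s1b; apply: cell_ok; lia.
  rewrite s1b; have [_ ->] := es1; last by lia.
  rewrite -[k * n]addn0 inpB//.
  wstep; apply: wp_add => //=; first by rewrite !(env_vars es1); apply: small; lia.
  rewrite !(env_vars es1) !addn0.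
  apply: wp_cons (erefl _) _; apply: wp_weaken (leqnn _) _.
    apply: (@wp_walk _ k) => //; by do 3 apply: env_set => //.
  move=> s2 [es2 [s2a s2b] wi /andP[t0 ltn] stop].
  have le_dn : k.+1 * n <= d * n by rewrite leq_mul2r ltk orbT.
  wstep; apply: wp_add => //=; first by rewrite s2a !(env_vars es2); apply: small; lia.
  rewrite s2a !(env_vars es2).
  wstep; apply: wp_add => //=; first by rewrite s2b !(env_vars es2); apply: small; lia.
  rewrite s2b !(env_vars es2) !addn0 -!addnA -![k * n + n]addnC -mulSn.
  apply: wp_nil; split.
    exists k.+1 => //; split=> //=; first by do 2 apply: env_set => //.
    (* A walk that ends before [n] ended at an early return of one of the two maps, which refutes
       [both k]. *)
    + move=> lt_t; move: stop; rewrite leqNgt lt_t /= => stop.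
      move=> k'; rewrite ltnS leq_eqVlt => /orP[/eqP-> [fA fB]|/none]; last exact.
      by case/orP: stop => /eqP z; [move: (fA (vars s2 vt)) | move: (fB (vars s2 vt))];
        rewrite z eqxx t0 lt_t => /(_ isT).
    + move=> le_t; split=> //; split=> m mP; case: (wi m) => //;
        by case/andP: mP => -> /leq_trans->.
  rewrite /count /= s1a !addKn !mulnK//.
  have -> : d - k = (d - k.+1).+1 by lia.
  by rewrite mulSn /=; lia.
- move=> s1 [k lek [es1 [s1a s1b] _ fk]].
  rewrite /= /lt_vars /= !(env_vars es1) andbT -leqNgt => /fk{fk}[k0 [fA fB]].
  case: k k0 lek s1a s1b fA fB => // k _ ltk s1a s1b fA fB.
  wstep; apply: wp_sub => //=; first by rewrite s1a !(env_vars es1); lia.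
  wstep; apply: wp_sub => //=; first by rewrite s1b !(env_vars es1); lia.
  apply: wp_nil; split; first by do 2 apply: env_set => //.
  exists k => //; split=> //; split=> /=; rewrite ?s1a ?s1b !(env_vars es1); lia.
Qed.


(** * Building the word of one tuple, for [F] either [A] or [B] *)

Section Build.

Variables (F : nat -> nat -> nat) (bs j : nat).
Hypotheses (ltj : j < d) (bs_le : bs + d * n <= 2 + 2 * (d * n)).
Hypothesis inpF : forall k z, k < d -> z < n -> inp (bs + (k * n + z)) = F k z.
Hypothesis F_lt : forall k z, k < d -> z < n -> F k z < n.
Hypothesis F_return : exists2 m, 0 < m <= n & iter m (F j) 0 = 0.
Hypothesis F_full : full_cycle n (F j).

Let f := F j.

Let f_lt z : z < n -> f z < n. Proof. exact: F_lt. Qed.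

Definition building (s0 s : vstate) : Prop :=
  [/\ env s, vars s vb = vars s0 vb, vars s vbase = bs & vars s vstep = bs + j * n].

Definition positions_upto (s : vstate) (i : nat) : Prop :=
  forall m, m < i -> cells s (2 + 2 * (d * n) + iter m f 0) = m.

Lemma wp_build_pos s0 : building s0 s0 ->
  wp build_pos s0 (7 * n + 5) (fun s => [/\ building s0 s, positions_upto s n,
    vars s vq = vars s0 vq &
    forall p, 2 + 2 * (d * n) + n <= p -> cells s p = cells s0 p]).
Proof.
move=> [es0 _ sb0 ss0]; rewrite (_ : 7 * n + 5 = (7 * n + 2 + 1).+2); last by lia.
wstep; apply: wp_add => //=; first by rewrite !(env_vars es0); apply: small; lia.
rewrite !(env_vars es0).
wstep; apply: wp_add => //=; first by rewrite !(env_vars es0); apply: small; lia.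
rewrite !(env_vars es0) !addn0.
apply: wp_cons (erefl _) _.
pose I s := exists2 i, i <= n & [/\ building s0 s /\ vars s vq = vars s0 vq,
  positions_upto s i, vars s vi = i, vars s vz = iter i f 0 &
  forall p, 2 + 2 * (d * n) + n <= p -> cells s p = cells s0 p].
apply: (wp_while w_gt0 S_lt le_LK (I := I) (mu := fun s => 7 * (n - vars s vi))).
- by exists 0 => //; split=> //=; split=> //; split=> //; do 2 apply: env_set => //.
- by rewrite /= subn0.
- move=> s1 [i _ [[[es1 sb sbase sstep] sq] pos s1i s1z s1c]].
  rewrite /= /lt_vars /= !(env_vars es1) s1i andbT => lti; exists 5.
  have ltz := iter_lt f_lt n_gt0 i; have ij := index_lt ltj ltz.
  wstep; apply: wp_add => //=; first by rewrite s1z !(env_vars es1); apply: small; lia.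
  rewrite s1z !(env_vars es1) addn0.
  wstep; apply: wp_store => //=; first by apply: cell_ok; lia.
    by rewrite s1i; apply: leq_trans n_lt; apply: ltnW.
  rewrite s1i; set s2 := set_cell _ _ _.
  have es2 : env s2 by apply: env_cell; [exact: env_set | exact: leq_addr].
  wstep; apply: wp_add => //=; first by rewrite s1z sstep; apply: small; lia.
  rewrite sstep s1z.
  wstep; apply: wp_load => //=; first by apply: cell_ok; lia.
  rewrite ltn_eqF; last by lia.
  have [_ ->] := es1; last by lia.
  rewrite addn0 -addnA inpF//.
  wstep; apply: wp_add => //=.
    by rewrite s1i !(env_vars es1); apply: small; lia.
  rewrite s1i !(env_vars es1) addn0 addn1.
  apply: wp_nil; split; last by rewrite /=; lia.
  exists i.+1 => //; split=> //=.
  + by split=> //; split=> //; do 3 apply: env_set => //.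
  + move=> m; rewrite ltnS leq_eqVlt => /orP[/eqP->|ltm] /=; first by rewrite eqxx.
    (* The points of the cycle are distinct, so the new table entry overwrites none of the earlier
       ones. *)
    rewrite eqn_add2l (negPf (full_cycle_inj n_gt0 F_full F_return _)) ?ltm//.
    exact: pos.
  + move=> p lep; rewrite gtn_eqF ?s1c//.
    by apply: leq_trans lep; rewrite ltn_add2l.
- move=> s1 [i lei [bs1 pos s1i s1z s1c]].
  have [[es1 _ _ _] sq] := bs1.
  rewrite /= /lt_vars /= !(env_vars es1) s1i andbT -leqNgt => le_ni.
  have {le_ni lei} ni : i = n by apply/eqP; rewrite eqn_leq lei.
  by rewrite ni in pos; apply: wp_nil; case: bs1; split.
Qed.

Definition positions (s : vstate) : Prop :=
  forall z, z < n -> cells s (2 + 2 * (d * n) + z) = index z (traject f 0 n).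

Lemma positions_uptoP s : positions_upto s n -> positions s.
Proof.
move=> pos z ltz.
have [lt iz] := full_cycle_index f_lt n_gt0 F_full F_return ltz.
by rewrite -{1}iz; apply: pos.
Qed.

Lemma letter_head i : letter n d F j (i * d.+1) = n.
Proof. by rewrite /letter modnMl. Qed.

Lemma letter_tail i k : k < d ->
  letter n d F j (i * d.+1 + k.+1) =
  cyclic_sub n (index (F k (iter i f 0)) (traject f 0 n)) i.
Proof.
move=> ltk; rewrite /letter modnMDl modn_small//.
by rewrite divnMDl// divn_small ?addn0.
Qed.

(** The last clause protects the first word while the second is built. The protected region starts
    after the position table, which is refilled for each tuple, and stops where the current word
    begins. *)
Definition built (s0 s : vstate) (q c : nat) : Prop :=
  [/\ building s0 s, positions s, vars s vq = q + c,
    forall p, p < c -> cells s (q + p) = letter n d F j p &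
    forall p, 2 + 2 * (d * n) + n <= p < q -> cells s p = cells s0 p].

Lemma built_set s0 s q c x v : built s0 s q c ->
  9 < x -> x \notin [:: vb; vbase; vstep; vq] -> built s0 (set_var s x v) q c.
Proof.
move=> [[es sb sbase sstep] pos sq sl sc] gtx.
rewrite !inE !negb_or => /and4P[/negPf x1 /negPf x2 /negPf x3 /negPf x4].
split=> //; last by rewrite /= eq_sym x4.
by split; [exact: env_set | rewrite /= eq_sym ?x1 ?x2 ?x3 ..].
Qed.

Lemma built_store s0 s q c : built s0 s q c -> 2 + 2 * (d * n) + n <= q ->
  built s0 (set_var (set_cell s (q + c) (letter n d F j c)) vq (q + c).+1) q c.+1.
Proof.
move=> [[es sb sbase sstep] pos sq sl sc] leq; split=> /=.
- by split=> //; apply: env_set => //; apply: env_cell => //; lia.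
- by move=> z ltz /=; rewrite ltn_eqF ?pos//; lia.
- by rewrite addnS.
- move=> p; rewrite ltnS leq_eqVlt => /orP[/eqP->|ltp]; first by rewrite eqxx.
  by rewrite eqn_add2l (ltn_eqF ltp) sl.
- by move=> p pP; rewrite ltn_eqF ?sc//; lia.
Qed.

Variables (q0 : nat).
Hypotheses (q0_ge : 2 + 2 * (d * n) + n <= q0)
  (q0_le : q0 + (d * n + n) <= size_mem).

Lemma wp_build_block s0 s i :
  built s0 s q0 (i * d.+1 + 1) -> i < n -> vars s vi = i -> vars s vz = iter i f 0 ->
  vars s vk = 0 -> vars s vr = bs + iter i f 0 ->
  wp build_block s (12 * d + 2) (fun s' => [/\ built s0 s' q0 (i.+1 * d.+1),
    vars s' vi = i & vars s' vz = iter i f 0]).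
Proof.
move=> bu lti si sz sk sr.
pose I s := exists2 k, k <= d & [/\ built s0 s q0 (i * d.+1 + k.+1),
  vars s vi = i, vars s vz = iter i f 0, vars s vk = k &
  vars s vr = bs + (k * n + iter i f 0)].
apply: (wp_while w_gt0 S_lt le_LK (I := I) (mu := fun s => 12 * (d - vars s vk))).
- by exists 0.
- by rewrite sk subn0.
- move=> s1 [k _ [bu1 s1i s1z s1k s1r]].
  have [[es1 _ _ _] pos s1q _ _] := bu1.
  rewrite /= /lt_vars /= !(env_vars es1) s1k andbT => ltk; exists 10.
  have ltz := iter_lt f_lt n_gt0 i; have ik := index_lt ltk ltz.
  have [ltv _] := full_cycle_index f_lt n_gt0 F_full F_return (F_lt ltk ltz).
  have lt_blk : i * d.+1 + k.+2 <= d * n + n.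
    apply: leq_trans (_ : i.+1 * d.+1 <= _); first by rewrite mulSn; lia.
    by rewrite -mulSnr mulnC leq_mul2l.
  wstep; apply: wp_load => //=; first by rewrite s1r; apply: cell_ok; lia.
  have [_ ec1] := es1; rewrite s1r ec1; last by lia.
  rewrite inpF//.
  wstep; apply: wp_add => //=.
    rewrite !(env_vars es1); apply: small; have := F_lt ltk ltz; lia.
  rewrite !(env_vars es1) addn0.
  wstep; apply: wp_load => //=; first by apply: cell_ok; have := F_lt ltk ltz; lia.
  rewrite pos ?F_lt//; set v := index _ _ in ltv *.
  have [s2 [-> bu2 s2i s2z [s2k s2r]]] : exists s2, [/\
      set_var (set_var (set_var s1 vv (F k (iter i f 0))) vv
        (2 + 2 * (d * n) + F k (iter i f 0))) vv v = set_var s2 vv v,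
      built s0 s2 q0 (i * d.+1 + k.+1), vars s2 vi = i, vars s2 vz = iter i f 0 &
      vars s2 vk = k /\ vars s2 vr = bs + (k * n + iter i f 0)].
    by eexists; split; first reflexivity; rewrite //; do 2 apply: built_set => //.
  apply: (@wp_cons _ _ _ 2 5) => //.
  (* Both branches are brought to the common form of a state with [vv] overwritten, so the remaining
     commands are treated once. *)
  apply: (@wp_weaken _ _ _ _ _ _ 2 2 (fun s => exists2 s', [/\
      built s0 s' q0 (i * d.+1 + k.+1), vars s' vi = i, vars s' vz = iter i f 0 &
      vars s' vk = k /\ vars s' vr = bs + (k * n + iter i f 0)] &
      s = set_var s' vv (if v < i then v + n else v))) => //.
    apply: wp_if => //=; rewrite s2i; case: ltnP => _; last first.
      by apply: wp_skip; exists s2.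
    apply: wp_add => //=.
      have [[es2 _ _ _] _ _ _ _] := bu2.
      by rewrite (env_vars es2); apply: small; lia.
    have [[es2 _ _ _] _ _ _ _] := bu2.
    rewrite (env_vars es2) addn0; exists (set_var s2 vv v) => //.
    by split=> //; exact: built_set.
  move=> _ [s3 [bu3 s3i s3z [s3k s3r]] ->].
  have [[es3 _ _ _] pos3 s3q _ _] := bu3.
  have lt_cyc : cyclic_sub n v i < n by rewrite /cyclic_sub; case: (ltnP v i) => ?; lia.
  wstep; apply: wp_sub => //=; first by rewrite s3i; case: (ltnP v i) => ?; lia.
  rewrite s3i -/(cyclic_sub n v i).
  wstep; apply: wp_store => //=; first by rewrite s3q; apply: cell_ok; lia.
    exact: ltn_trans lt_cyc n_lt.
  wstep; apply: wp_add => //=.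
    by rewrite s3q (env_vars es3); apply: small; lia.
  rewrite s3q (env_vars es3) addn0 addn1.
  wstep; apply: wp_add => //=.
    by rewrite s3r (env_vars es3); apply: small; have := index_lt ltk ltz; lia.
  wstep; apply: wp_add => //=.
    by rewrite s3k (env_vars es3); apply: small; lia.
  rewrite s3r s3k !(env_vars es3) !addn0 addn1.
  apply: wp_nil; split; last by rewrite /=; lia.
  exists k.+1 => //; split=> //=; last by rewrite mulSn; lia.
  do 2 apply: built_set => //.
  rewrite [i * d.+1 + k.+2]addnS -letter_tail//.
  apply: (@built_store s0 (set_var (set_var s3 vv _) vv _)) => //.
  by do 2 apply: built_set => //.
- move=> s1 [k lek [bu1 s1i s1z s1k s1r]].
  have [[es1 _ _ _] _ _ _ _] := bu1.
  rewrite /= /lt_vars /= !(env_vars es1) s1k andbT -leqNgt => ledk.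
  have kd : k = d by apply/eqP; rewrite eqn_leq lek.
  by rewrite kd -mulSnr in bu1.
Qed.

Lemma wp_build_letters s0 : building s0 s0 -> positions s0 -> vars s0 vq = q0 ->
  wp build_letters s0 (n * (12 * d + 11) + 5) (fun s => built s0 s q0 (n * d.+1)).
Proof.
move=> bu0 pos0 sq0; have [es0 _ _ _] := bu0.
rewrite (_ : n * _ + 5 = (n * (12 * d + 11) + 2 + 1).+2); last by lia.
wstep; apply: wp_add => //=; first by rewrite !(env_vars es0); apply: small; lia.
rewrite !(env_vars es0).
wstep; apply: wp_add => //=; first by rewrite !(env_vars es0); apply: small; lia.
rewrite !(env_vars es0) !addn0.
apply: wp_cons (erefl _) _.
pose I s := exists2 i, i <= n & [/\ built s0 s q0 (i * d.+1), vars s vi = i &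
  vars s vz = iter i f 0].
apply: (wp_while w_gt0 S_lt le_LK (I := I)
  (mu := fun s => (n - vars s vi) * (12 * d + 11))).
- exists 0 => //; split=> //; do 2 apply: built_set => //.
  by split=> //; rewrite sq0 addn0.
- by rewrite /= subn0.
- move=> s1 [i _ [bu1 s1i s1z]]; have [[es1 _ _ _] pos s1q _ _] := bu1.
  rewrite /= /lt_vars /= !(env_vars es1) s1i andbT => lti; exists (12 * d + 9).
  have ltz := iter_lt f_lt n_gt0 i; have ij := index_lt ltj ltz.
  have lt_blk : i * d.+1 + d.+1 <= d * n + n.
    by rewrite -!mulSnr mulnC leq_mul2l.
  rewrite (_ : 12 * d + 9 = (12 * d + 2 + 3).+4); last by lia.
  wstep; apply: wp_store => //=; first by rewrite s1q; apply: cell_ok; lia.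
    by rewrite (env_vars es1).
  rewrite s1q (env_vars es1).
  wstep; apply: wp_add => //=.
    by rewrite s1q (env_vars es1); apply: small; lia.
  rewrite s1q (env_vars es1) addn0 addn1.
  wstep; apply: wp_add => //=.
    by have [[_ _ -> _] _ _ _ _] := bu1; rewrite s1z; apply: small; lia.
  have [[_ _ -> _] _ _ _ _] := bu1; rewrite s1z addn0.
  wstep; apply: wp_add => //=; first by rewrite !(env_vars es1); apply: small; lia.
  rewrite !(env_vars es1) !addn0.
  apply: wp_cons (erefl _) _; apply: wp_weaken (leqnn _) _.
    apply: (@wp_build_block s0 _ i) => //=.
    do 2 apply: built_set => //; rewrite addn1 -{1}(letter_head i).
    exact: built_store.
  move=> s2 [bu2 s2i s2z]; have [[es2 _ _ s2s] _ _ _ _] := bu2.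
  wstep; apply: wp_add => //=; first by rewrite s2s s2z; apply: small; lia.
  rewrite s2s s2z.
  wstep; apply: wp_load => //=; first by apply: cell_ok; lia.
  have [_ ->] := es2; last by lia.
  rewrite addn0 -addnA inpF//.
  wstep; apply: wp_add => //=.
    by rewrite s2i !(env_vars es2); apply: small; lia.
  rewrite s2i !(env_vars es2) addn0 addn1.
  apply: wp_nil; split.
    by exists i.+1 => //; split=> //; do 3 apply: built_set => //.
  have -> : n - i = (n - i.+1).+1 by lia.
  by rewrite mulSn /=; lia.
- move=> s1 [i lei [bu1 s1i s1z]]; have [[es1 _ _ _] _ _ _ _] := bu1.
  rewrite /= /lt_vars /= !(env_vars es1) s1i andbT -leqNgt => le_ni.
  have ni : i = n by apply/eqP; rewrite eqn_leq lei.
  by rewrite ni in bu1; apply: wp_nil.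
Qed.

End Build.

(** * Comparing the two words up to rotation *)

Local Notation N := (d * n + n).

Lemma wp_fetch_letter s dst word start wd i t :
  env s -> 9 < dst -> word < 10 -> vars s word = wd -> start != vr -> 
  wd + N <= size_mem -> vars s start = i -> vars s vt = t -> i < N -> t < N ->
  wp (fetch_letter dst word start) s 5 (fun s' => [/\ env s', cells s' =1 cells s,
    vars s' dst = cells s (wd + (i + t) %% N) &
    forall x, x != vr -> x != dst -> vars s' x = vars s x]).
Proof.
move=> es gtdst ltword sw nstart le_wd si st lti ltt.
have N_gt0 : 0 < N by apply: leq_ltn_trans lti.
wstep; apply: wp_add => //=; first by rewrite si st; apply: small; lia.
rewrite si st addn0; set s1 := set_var s vr _.
apply: (@wp_cons _ _ _ 2 2) => //.
pose after s2 := [/\ env s2, vars s2 vr = (i + t) %% N, cells s2 =1 cells s &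
  forall x, x != vr -> vars s2 x = vars s x].
have upd_vr v s2 x : x != vr -> vars (set_var s2 vr v) x = vars s2 x.
  by rewrite /= => /negPf->.
apply: (@wp_weaken _ _ _ _ _ _ 2 2 after) => //.
  have es1 : env s1 by apply: env_set.
  apply: wp_if => //; rewrite (env_vars es1); case: ltnP => cmp.
    apply: wp_skip; split=> // [|x xr]; last by rewrite upd_vr.
    by rewrite modn_small.
  apply: wp_sub => //; first by rewrite (env_vars es1).
  rewrite (env_vars es1); split=> //; first by apply: env_set.
    have {}cmp : N <= i + t by [].
    by rewrite /= -{2}(subnK cmp) modnDr modn_small//; lia.
  by move=> x xr; rewrite !upd_vr.
move=> s2 [es2 s2r s2c s2E].
have ltr : (i + t) %% N < N by apply: ltn_pmod.
have s2w : vars s2 word = wd by rewrite s2E// neq_ltn (leq_trans ltword).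
wstep; apply: wp_add => //=; first by rewrite s2w s2r; apply: small; lia.
rewrite s2w s2r addn0.
wstep; apply: wp_load => //=; first by case: dst gtdst.
  by apply: cell_ok; lia.
apply: wp_nil; split=> //=.
- by do 2 apply: env_set => //.
- by rewrite eqxx s2c.
- by move=> x /[dup] xr /negPf-> /negPf->; apply: s2E.
Qed.

(** A round costs 14 for the body and 4 for the guard and the jump back; at most [3 * N] rounds give
    [54 * N]. *)
Lemma wp_compare s : env s ->
  let U p := cells s (2 + 2 * (d * n) + n + p) in
  let V p := cells s (2 + 3 * (d * n) + 2 * n + p) in
  wp compare s (54 * N + 8) (fun s' => env s' /\
    (N <= vars s' vt <-> rotation_of N U V)).
Proof.
move=> es U V; have N_gt0 : 0 < N by rewrite addn_gt0 n_gt0 orbT.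
rewrite (_ : 54 * N + 8 = (54 * N + 4 + 1).+3); last by lia.
have lt0 : 0 < 2 ^ (w * K) by apply: small.
wstep; apply: wp_add => //=; first by rewrite !(env_vars es).
rewrite !(env_vars es).
wstep; apply: wp_add => //=; first by rewrite !(env_vars es).
rewrite !(env_vars es).
wstep; apply: wp_add => //=; first by rewrite !(env_vars es).
rewrite !(env_vars es) !addn0.
apply: wp_cons (erefl _) _.
pose I s1 := [/\ env s1, cells s1 =1 cells s,
  dominated N U V (vars s1 vi) /\ dominated N V U (vars s1 vj),
  forall m, m < vars s1 vt ->
    rot_from N U (vars s1 vi) m = rot_from N V (vars s1 vj) m &
  vars s1 vt <= N /\ vars s1 vi + vars s1 vj + vars s1 vt <= 3 * N].
apply: (wp_while w_gt0 S_lt le_LK (I := I)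
  (mu := fun s => 18 * (3 * N - (vars s vi + vars s vj + vars s vt)))).
- by split=> //=; do 3 apply: env_set => //.
- by rewrite /=; lia.
- move=> s1 [es1 s1c [domU domV] agree [_ le3N]].
  rewrite /= /lt_vars /= !(env_vars es1) andbT => /and3P[lti ltj ltt]; exists 14.
  set i := vars s1 vi in lti agree domU le3N *.
  set j := vars s1 vj in ltj agree domV le3N *.
  set t := vars s1 vt in ltt agree le3N *.
  apply: (@wp_cons _ _ _ 5 9) => //; apply: wp_weaken (leqnn _) _.
    apply: (@wp_fetch_letter s1 vu vU vi (2 + 2 * (d * n) + n) i t) => //;
      by [rewrite (env_vars es1) | lia].
  move=> s2 [es2 s2c s2u s2E].
  apply: (@wp_cons _ _ _ 5 4) => //; apply: wp_weaken (leqnn _) _.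
    apply: (@wp_fetch_letter s2 vv vV vj (2 + 3 * (d * n) + 2 * n) j t) => //;
      by [rewrite (env_vars es2) | exact: s2E | lia].
  move=> s3 [es3 s3c s3v s3E].
  have s3u : vars s3 vu = rot_from N U i t by rewrite s3E// s2u s1c.
  have {}s3v : vars s3 vv = rot_from N V j t by rewrite s3v s2c s1c.
  have s3i : vars s3 vi = i by rewrite s3E// s2E.
  have s3j : vars s3 vj = j by rewrite s3E// s2E.
  have s3t : vars s3 vt = t by rewrite s3E// s2E.
  have {s2c} s3c' : cells s3 =1 cells s by move=> p; rewrite s3c s2c s1c.
  apply: wp_cons (addn0 _) _.
  apply: (@wp_weaken _ _ _ _ _ _ 4 4 (fun s2 : vstate =>
      I s2 /\ vars s2 vi + vars s2 vj + vars s2 vt = (i + j + t).+1)) => //; last first.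
    by move=> s4 [I4 eq4]; apply: wp_nil; split=> //; rewrite eq4; lia.
  (* All three are below [N] at the start of a round, so the sum may grow by one. A skip can take
     [i] or [j] past [N], but the sum stays within [3 * N]. *)
  have bound : i + j + t < 3 * N by lia.
  have sm v : v <= 3 * N -> v < 2 ^ (w * K) by move=> le; apply: small; lia.
  apply: wp_if => //; rewrite s3u s3v; case: ltngtP => cmp; last first.
  + apply: wp_if => //; rewrite s3u s3v cmp ltnn.
    apply: wp_add => //=; first by rewrite s3t !(env_vars es3); apply: sm; lia.
    rewrite s3t (env_vars es3) addn0 addn1 s3i s3j addnS; split=> //; split=> //=.
    * exact: env_set.
    * by rewrite s3i s3j.
    * move=> m; rewrite s3i s3j ltnS leq_eqVlt => /orP[/eqP->//|]; exact: agree.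
    * by rewrite s3i s3j; lia.
  + apply: wp_if => //; rewrite s3u s3v cmp.
    wstep; apply: wp_add => //=; first by rewrite s3i s3t; apply: sm; lia.
    rewrite s3i s3t.
    wstep; apply: wp_add => //=; first by rewrite !(env_vars es3).
    rewrite !(env_vars es3) !addn0 addn1.
    apply: wp_nil; rewrite /= s3j; split; last by lia.
    split=> //=; rewrite ?s3j.
    * by do 2 apply: env_set => //.
    * split=> //; apply: dominated_mismatch ltt _ cmp domU.
      by move=> m /agree.
    * by lia.
  + wstep; apply: wp_add => //=; first by rewrite s3j s3t; apply: sm; lia.
    rewrite s3j s3t.
    wstep; apply: wp_add => //=; first by rewrite !(env_vars es3).
    rewrite !(env_vars es3) !addn0 addn1.
    apply: wp_nil; rewrite /= s3i; split; last by lia.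
    split=> //=; rewrite ?s3i.
    * by do 2 apply: env_set => //.
    * by split=> //; apply: dominated_mismatch ltt _ cmp domV.
    * by lia.
- move=> s1 [es1 s1c [domU domV] agree [leN _]].
  rewrite /= /lt_vars /= !(env_vars es1) andbT => stop.
  apply: wp_nil; split=> //; split=> [leNt|rot].
    apply: (rot_from_rotation (i := vars s1 vi) (j := vars s1 vj)) => // m ltm.
    by apply: agree; apply: leq_trans leNt.
  (* If the words are rotations of each other, neither candidate has reached [N], so only [t] can
     have stopped the loop. *)
  move: stop; rewrite (rotation_not_dominated N_gt0 rot domU).
  by rewrite (rotation_not_dominated N_gt0 (rotation_of_sym rot) domV) /= -leqNgt.
Qed.


Hypothesis B_return : forall k, k < d -> exists2 m, 0 < m <= n & iter m (B k) 0 = 0.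

Lemma wp_conj_test s : vars s 0 = 0 -> cells s =1 inp ->
  wp conj_test s (300 * (d * n)) (fun s' => env s' /\
    exists2 k, k < d & [/\ full_cycle n (A k), full_cycle n (B k) &
      N <= vars s' vt <-> rotation_of N (letter n d A k) (letter n d B k)]).
Proof.
move=> s0 sc; have dn_gt0 : 0 < d * n by rewrite muln_gt0 d_gt0.
apply: (@wp_weaken _ _ _ _ _ _
  ((4 * d + 13) + ((d * (8 * n + 10) + 7) + (1 + (1 + (1 + ((7 * n + 5) +
    ((n * (12 * d + 11) + 5) + (1 + (1 + ((7 * n + 5) +
    ((n * (12 * d + 11) + 5) + ((54 * N + 8) + 1)))))))))))) _
  (fun s' => env s' /\
    exists2 k, k < d & [/\ full_cycle n (A k), full_cycle n (B k) &
      N <= vars s' vt <-> rotation_of N (letter n d A k) (letter n d B k)])) => //;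
  last first.
  (* The costs add up to [86 * (d * n) + 14 * d + 90 * n + 54], at most [244 * (d * n)] because [d]
     and [n] are positive. *)
  have le_d : d <= d * n by apply: leq_pmulr.
  have le_n : n <= d * n by apply: leq_pmull.
  by nia.
apply: wp_cons (erefl _) _; apply: wp_weaken (leqnn _) _; first exact: wp_setup.
move=> s1 es1.
apply: wp_cons (erefl _) _; apply: wp_weaken (leqnn _) _; first exact: wp_find_cycle.
move=> s2 [es2 [j ltj [[s2a s2b] fullA fullB]]].
have ij : j * n + 0 < d * n by apply: index_lt.
wstep; apply: wp_add => //=; first by rewrite !(env_vars es2); apply: small; lia.
rewrite !(env_vars es2).
wstep; apply: wp_add => //=; first by rewrite !(env_vars es2); apply: small; lia.
rewrite !(env_vars es2).
wstep; apply: wp_add => //=; first by rewrite s2a !(env_vars es2); apply: small; lia.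
rewrite s2a !(env_vars es2) !addn0.
set s3 := set_var _ vstep _.
have bu3 : building 2 j s3 s3 by split=> //; do 3 apply: env_set => //.
apply: wp_cons (erefl _) _; apply: wp_weaken (leqnn _) _.
  by apply: (wp_build_pos ltj _ inpA A_lt (A_return ltj) fullA bu3); lia.
move=> s4 [bu4 pos4 s4q s4c].
have {}s4q : vars s4 vq = 2 + 2 * (d * n) + n by rewrite s4q.
have bu44 : building 2 j s4 s4 by case: bu4; split.
have {}pos4 := positions_uptoP ltj A_lt (A_return ltj) fullA pos4.
apply: wp_cons (erefl _) _; apply: wp_weaken (leqnn _) _.
  apply: (wp_build_letters ltj _ inpA A_lt (A_return ltj) fullA _ _ bu44 pos4 s4q);
    lia.
move=> s5 [[es5 s5b _ _] _ s5q s5l s5c].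
have {}s5b : vars s5 vb = 2 + d * n + j * n by rewrite s5b; case: bu4 => _ -> _ _.
wstep; apply: wp_add => //=; first by rewrite !(env_vars es5); apply: small; lia.
rewrite !(env_vars es5).
wstep; apply: wp_add => //=; first by rewrite s5b !(env_vars es5); apply: small; lia.
rewrite s5b !(env_vars es5) !addn0.
set s6 := set_var _ vstep _.
have bu6 : building (2 + d * n) j s6 s6.
  by split=> //; do 2 apply: env_set => //.
apply: wp_cons (erefl _) _; apply: wp_weaken (leqnn _) _.
  by apply: (wp_build_pos ltj _ inpB B_lt (B_return ltj) fullB bu6); lia.
move=> s7 [bu7 pos7 s7q s7c].
have bu77 : building (2 + d * n) j s7 s7 by case: bu7; split.
have {}pos7 := positions_uptoP ltj B_lt (B_return ltj) fullB pos7.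
(* The output pointer is not reset between the words: after [n * d.+1] letters it stands at the
   start of the second one. *)
have {}s7q : vars s7 vq = 2 + 3 * (d * n) + 2 * n.
  by rewrite s7q /= s5q; rewrite mulnS [n * d]mulnC; lia.
apply: wp_cons (erefl _) _; apply: wp_weaken (leqnn _) _.
  apply: (wp_build_letters ltj _ inpB B_lt (B_return ltj) fullB _ _ bu77 pos7 s7q);
    lia.
move=> s8 [[es8 _ _ _] _ _ s8l s8c].
apply: wp_cons (erefl _) _; apply: wp_weaken (leqnn _) _; first exact: (wp_compare es8).
move=> s9 [es9 s9P]; apply: wp_nil; split=> //; exists j => //; split=> //.
have NE : N = n * d.+1 by rewrite mulnS [n * d]mulnC addnC.
have N_gt0 : 0 < N by rewrite addn_gt0 n_gt0 orbT.
have U8 p : p < N -> cells s8 (2 + 2 * (d * n) + n + p) = letter n d A j p.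
  by move=> ltp; rewrite s8c ?s7c -?s5l -?NE//; lia.
have V8 p : p < N -> cells s8 (2 + 3 * (d * n) + 2 * n + p) = letter n d B j p.
  by move=> ltp; rewrite s8l// -NE.
by apply: iff_trans s9P _; split=> -[r ltr eq]; exists r => // m ltm;
  have := eq m ltm; rewrite U8// V8// ltn_pmod.
Qed.

End Program.

(** * Input encoding and conjugacy *)

Section Encoding.

Variables (w L : nat).
Hypothesis w_gt0 : 0 < w.

Lemma address_digits k l x :
  address w (fun i => x %/ 2 ^ (w * i) %% 2 ^ w) (iota k l) =
  x %/ 2 ^ (w * k) %% 2 ^ (w * l).
Proof.
elim: l k => [|l IH] k /=; first by rewrite muln0 modn1.
rewrite IH !mulnS !expnD [2 ^ w * 2 ^ (w * k)]mulnC divnMA.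
move: (x %/ _) => y; rewrite [RHS](divn_eq _ (2 ^ w)) modn_dvdm ?dvdn_mulr//.
by rewrite [2 ^ w * 2 ^ (w * l)]mulnC -modn_divl addnC mulnC.
Qed.

Lemma address_words_nth xs p :
  all (fun x => x < 2 ^ (w * L)) xs ->
  address w (nth 0 (flatten (map (words w L) xs))) (iota (L * p) L) = nth 0 xs p.
Proof.
have size_words x : size (words w L x) = L by rewrite size_mkseq.
elim: xs p => [|x xs IH] p /=.
  (* Past the input both sides read the default 0, so the encoding is correct for every cell. *)
  by rewrite nth_nil address0// => r _; rewrite nth_nil.
move=> /andP[ltx lts]; case: p => [|p] /=.
  rewrite muln0; transitivity (x %/ 2 ^ (w * 0) %% 2 ^ (w * L)); last first.
    by rewrite muln0 divn1 modn_small.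
  rewrite -address_digits; apply: eq_in_address => r.
  by rewrite mem_iota => /andP[_ ltr]; rewrite nth_cat size_words ltr nth_mkseq.
rewrite -IH// mulnS address_iota_shift; apply: eq_in_address => r _.
by rewrite nth_cat size_words ltnNge leq_addr addKn.
Qed.

Lemma words_word xs r : nth 0 (flatten (map (words w L) xs)) r < 2 ^ w.
Proof.
have [lt|le] := ltnP r (size (flatten (map (words w L) xs))); last first.
  by rewrite nth_default// expn_gt0.
have /flatten_mapP[x _ /mapP[i _ ->]] := mem_nth 0 lt.
by rewrite ltn_pmod ?expn_gt0.
Qed.

End Encoding.

Lemma nth_flatten_uniform (T : Type) (x0 : T) (ss : seq (seq T)) n k z :
  all (fun s => size s == n) ss -> k < size ss -> z < n ->
  nth x0 (flatten ss) (k * n + z) = nth x0 (nth [::] ss k) z.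
Proof.
elim: ss k => // s ss IH [|k] /= /andP[/eqP ss_n alln] ltk ltz.
  by rewrite nth_cat ss_n ltz.
by rewrite nth_cat ss_n mulSn -addnA ltnNge leq_addr addKn IH.
Qed.

Lemma size_flatten_uniform (T : Type) (ss : seq (seq T)) n :
  all (fun s => size s == n) ss -> size (flatten ss) = size ss * n.
Proof.
by elim: ss => //= s ss IH /andP[/eqP sn /IH szE]; rewrite size_cat mulSn sn szE.
Qed.

Section PermValues.

Variables (n d : nat).
Implicit Types (a b : d.-tuple 'S_n) (s : 'S_n).

Lemma size_perm_values s : size (perm_values s) = n.
Proof. by rewrite size_map size_enum_ord. Qed.

Lemma all_size_perm_values a :
  all (fun vs => size vs == n) (map (@perm_values n) a).
Proof. by rewrite all_map; apply/allP => s _ /=; rewrite size_perm_values. Qed.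

Lemma nth_perm_values a (k : 'I_d) (z : 'I_n) :
  nth 0 (flatten (map (@perm_values n) a)) (k * n + z) = tnth a k z.
Proof.
rewrite (nth_flatten_uniform _ (all_size_perm_values a)) ?size_map ?size_tuple//.
rewrite (nth_map 1%g) ?size_tuple// -tnth_nth /perm_values.
by rewrite (nth_map z) ?size_enum_ord// nth_ord_enum.
Qed.

Lemma size_flatten_perm_values a :
  size (flatten (map (@perm_values n) a)) = d * n.
Proof.
by rewrite (size_flatten_uniform (all_size_perm_values a)) size_map size_tuple.
Qed.

Lemma input_ints_fst a b (k : 'I_d) (z : 'I_n) :
  nth 0 (input_ints a b) (2 + (k * n + z)) = tnth a k z.
Proof.
rewrite /= nth_cat size_flatten_perm_values index_lt//.
exact: nth_perm_values.
Qed.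

Lemma input_ints_snd a b (k : 'I_d) (z : 'I_n) :
  nth 0 (input_ints a b) (2 + d * n + (k * n + z)) = tnth b k z.
Proof.
rewrite -addnA /= add0n nth_cat size_flatten_perm_values ltnNge leq_addr addKn.
exact: nth_perm_values.
Qed.

Lemma input_ints_lt a b x M :
  n < M -> d < M -> x \in input_ints a b -> x < M.
Proof.
have val_lt c : x \in flatten (map (@perm_values n) c) -> x < n.
  by move=> /flatten_mapP[s _ /mapP[i _ ->]]; apply: ltn_ord.
move=> ltn ltd; rewrite !inE mem_cat => /or3P[/eqP->//|/eqP->//|].
by move=> /orP[]/val_lt/ltn_trans->.
Qed.

End PermValues.

(** * Rotations of the words and simultaneous conjugators *)

Section Conjugacy.

Variables (n : nat) (n_gt0 : 0 < n).

Lemma iter_modn f m : iter n f 0 = 0 -> iter m f 0 = iter (m %% n) f 0.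
Proof.
move=> fn; rewrite {1}(divn_eq m n) addnC iterD.
by congr (iter _ f _); elim: (m %/ n) => // q IH; rewrite mulSn iterD IH.
Qed.

Lemma cyclic_sub_lt v i : v < n -> i < n -> cyclic_sub n v i < n.
Proof. by move=> ltv lti; rewrite /cyclic_sub; case: (ltnP v i) => ?; lia. Qed.

Lemma modn_add i r : i < n -> r < n ->
  (i + r) %% n = if i + r < n then i + r else i + r - n.
Proof.
move=> lti ltr; case: ltnP => [/modn_small//|le].
by rewrite -{1}(subnK le) modnDr modn_small//; lia.
Qed.

(** Modulo [n], the differences [v - i] and [v' - (i + r)] agree exactly when [v'] is [v + r]: a
    letter survives the move of its block by [r] when the position it encodes moves by [r] too. *)
Lemma cyclic_sub_shift v v' i r : v < n -> v' < n -> i < n -> r < n ->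
  (cyclic_sub n v i = cyclic_sub n v' ((i + r) %% n)) <-> v' = (v + r) %% n.
Proof.
move=> ltv ltv' lti ltr; rewrite !modn_add// /cyclic_sub.
case: (ltnP (i + r) n) => ?; case: (ltnP (v + r) n) => ?;
  case: (ltnP v i) => ?; [case: (ltnP v' (i + r)) => ?..|
  case: (ltnP v' (i + r)) => ?|case: (ltnP v' (i + r)) => ?|
  case: (ltnP v' (i + r - n)) => ?|case: (ltnP v' (i + r - n)) => ?|
  case: (ltnP v' (i + r - n)) => ?|case: (ltnP v' (i + r - n)) => ?]; lia.
Qed.

Lemma modn_block q e D : e < D -> (q * D + e) %% (n * D) = q %% n * D + e.
Proof.
move=> lte; rewrite {1}(divn_eq q n) mulnDl -addnA -mulnA modnMDl modn_small//.
apply: (@leq_trans ((q %% n).+1 * D)); first by rewrite mulSn addnC ltn_add2r.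
by rewrite leq_mul2r ltn_pmod ?orbT.
Qed.

Section Letters.

Variables (d j : nat) (A B : nat -> nat -> nat).
Hypothesis ltj : j < d.
Hypotheses (A_lt : forall k z, k < d -> z < n -> A k z < n)
  (B_lt : forall k z, k < d -> z < n -> B k z < n).
Hypotheses (A_return : exists2 m, 0 < m <= n & iter m (A j) 0 = 0)
  (B_return : exists2 m, 0 < m <= n & iter m (B j) 0 = 0).
Hypotheses (A_full : full_cycle n (A j)) (B_full : full_cycle n (B j)).

Let posA z := index z (traject (A j) 0 n).
Let posB z := index z (traject (B j) 0 n).

Lemma posA_lt k i : k < d -> posA (A k (iter i (A j) 0)) < n.
Proof.
move=> ltk; have Aj_lt z : z < n -> A j z < n by apply: A_lt.
have [] // := full_cycle_index Aj_lt n_gt0 A_full A_return (z := A k (iter i (A j) 0)).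
exact/A_lt/iter_lt.
Qed.

Lemma posB_lt k i : k < d -> posB (B k (iter i (B j) 0)) < n.
Proof.
move=> ltk; have Bj_lt z : z < n -> B j z < n by apply: B_lt.
have [] // := full_cycle_index Bj_lt n_gt0 B_full B_return (z := B k (iter i (B j) 0)).
exact/B_lt/iter_lt.
Qed.

(** The separator [n] at the head of the first word has to meet a separator of the second, all other
    letters being below [n]. So the rotation is by a whole number [r] of blocks, and
    [cyclic_sub_shift] translates the remaining equalities letter by letter. *)
Lemma rotation_letterP :
  rotation_of (d * n + n) (letter n d A j) (letter n d B j) <->
  exists2 r, r < n & forall k i, k < d -> i < n ->
    posB (B k (iter (i + r) (B j) 0)) = (posA (A k (iter i (A j) 0)) + r) %% n.
Proof.
have NE : d * n + n = n * d.+1 by rewrite -mulSnr mulnC.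
have iterB m : iter m (B j) 0 = iter (m %% n) (B j) 0.
  exact/iter_modn/full_cycle_return.
rewrite NE; split=> [[s lts eq]|[r ltr eq]].
- have s_div : s %/ d.+1 < n by rewrite ltn_divLR.
  have s0 : s %% d.+1 = 0.
    have := eq 0; rewrite muln_gt0 n_gt0 => /(_ isT).
    rewrite add0n modn_small// -{1}[0](mul0n d.+1) letter_head /letter.
    case E : (s %% d.+1) => [//|k] nE; have ltk : k < d.
      by have := ltn_pmod s (ltn0Sn d); rewrite E.
    have := cyclic_sub_lt (posB_lt (s %/ d.+1) ltk) s_div.
    by rewrite /posB -nE ltnn.
  have sE : s = s %/ d.+1 * d.+1 by rewrite {1}(divn_eq s d.+1) s0 addn0.
  exists (s %/ d.+1) => // k i ltk lti; set r := s %/ _ in sE s_div *.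
  rewrite iterB; apply/(cyclic_sub_shift (posA_lt i ltk) (posB_lt _ ltk) lti s_div).
  have lt_m : i * d.+1 + k.+1 < n * d.+1.
    rewrite -(modn_small lti) -modn_block ?ltn_pmod ?muln_gt0 ?n_gt0//.
  have := eq _ lt_m; rewrite sE addnAC -mulnDl modn_block//.
  by rewrite !letter_tail.
- exists (r * d.+1) => [|m ltm]; first by rewrite ltn_mul2r.
  have lti : m %/ d.+1 < n by rewrite ltn_divLR.
  have lte : m %% d.+1 < d.+1 by apply: ltn_pmod.
  rewrite {1 2}(divn_eq m d.+1) addnAC -mulnDl modn_block//.
  case: (m %% d.+1) lte => [_|k ltk]; first by rewrite !addn0 !letter_head.
  rewrite !letter_tail//.
  apply/(cyclic_sub_shift (posA_lt _ ltk) (posB_lt _ ltk) lti ltr).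
  by rewrite -iterB -eq.
Qed.

End Letters.

Section Perms.

Variables (d : nat) (a b : d.-tuple 'S_n) (A B : nat -> nat -> nat).
Hypothesis A_val : forall (k : 'I_d) (z : 'I_n), A k z = tnth a k z.
Hypothesis B_val : forall (k : 'I_d) (z : 'I_n), B k z = tnth b k z.

Definition origin : 'I_n := Ordinal n_gt0.

Lemma iter_perm (F : nat -> nat -> nat) (c : d.-tuple 'S_n) (k : 'I_d) m (z : 'I_n) :
  (forall (k : 'I_d) (z : 'I_n), F k z = tnth c k z) ->
  iter m (F k) z = iter m (tnth c k) z.
Proof. by move=> F_val; elim: m => //= m ->; rewrite F_val. Qed.

Lemma perm_values_lt (F : nat -> nat -> nat) (c : d.-tuple 'S_n) :
  (forall (k : 'I_d) (z : 'I_n), F k z = tnth c k z) ->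
  forall k z, k < d -> z < n -> F k z < n.
Proof.
by move=> F_val k z ltk ltz; rewrite (F_val (Ordinal ltk) (Ordinal ltz)).
Qed.

Lemma perm_return (F : nat -> nat -> nat) (c : d.-tuple 'S_n) :
  (forall (k : 'I_d) (z : 'I_n), F k z = tnth c k z) ->
  forall k, k < d -> exists2 m, 0 < m <= n & iter m (F k) 0 = 0.
Proof.
move=> F_val k ltk; pose k' := Ordinal ltk.
exists #|porbit (tnth c k') origin|.
  rewrite lt0n card_porbit_neq0 /=.
  by apply: leq_trans (max_card _) _; rewrite card_ord.
by rewrite (iter_perm k' _ origin F_val) iter_porbit.
Qed.

(** An orbit with [n] elements is all of ['I_n], hence also the orbit of 0, whose first [n] points
    are distinct. *)
Lemma ncycle_full (F : nat -> nat -> nat) (c : d.-tuple 'S_n) (k : 'I_d) :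
  (forall (k : 'I_d) (z : 'I_n), F k z = tnth c k z) ->
  is_ncycle (tnth c k) -> full_cycle n (F k).
Proof.
move=> F_val [x cx] m /andP[m_gt0 ltm].
have orb : #|porbit (tnth c k) origin| = n.
  have all_x : porbit (tnth c k) x =i 'I_n.
    by apply/subset_cardP; [rewrite card_ord | apply/subsetP].
  have /eqP-> : porbit (tnth c k) origin == porbit (tnth c k) x.
    by rewrite eq_porbit_mem all_x.
  exact: cx.
have := uniq_traject_porbit (tnth c k) origin; rewrite orb => uniq_tr.
rewrite (iter_perm k m origin F_val); apply/eqP => iter0.
have : nth origin (traject (tnth c k) origin n) m =
       nth origin (traject (tnth c k) origin n) 0.
  by rewrite !nth_traject//; apply: val_inj.
by move/eqP; rewrite nth_uniq ?size_traject//; case: m m_gt0 {ltm iter0}.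
Qed.

(** With products read from left to right, conjugacy means [tau (a_k z) = b_k (tau z)]. For [k = j]
    this forces [tau] to carry [x_i] to [y_(i+r)], where [r] is the position of [tau 0] on the cycle
    of [b_j]; for the other [k] it becomes the condition of [rotation_letterP]. *)
Lemma conjugate_iff (j : 'I_d) :
  full_cycle n (A j) -> full_cycle n (B j) ->
  (rotation_of (d * n + n) (letter n d A j) (letter n d B j) <->
   exists tau : 'S_n, forall k : 'I_d, tnth b k = (tau^-1 * tnth a k * tau)%g).
Proof.
move=> A_full B_full; have ltj := ltn_ord j.
have A_lt := perm_values_lt A_val; have B_lt := perm_values_lt B_val.
have A_ret := perm_return A_val ltj; have B_ret := perm_return B_val ltj.
apply: iff_trans (rotation_letterP ltj A_lt B_lt A_ret B_ret A_full B_full) _.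
have Aj_lt z : z < n -> A j z < n by apply: A_lt.
have Bj_lt z : z < n -> B j z < n by apply: B_lt.
pose posA (z : nat) := index z (traject (A j) 0 n).
pose posB (z : nat) := index z (traject (B j) 0 n).
have posAK z : z < n -> iter (posA z) (A j) 0 = z.
  by move=> /(full_cycle_index Aj_lt n_gt0 A_full A_ret)[].
have posBK z : z < n -> iter (posB z) (B j) 0 = z.
  by move=> /(full_cycle_index Bj_lt n_gt0 B_full B_ret)[].
have posA_n z : z < n -> posA z < n.
  by move=> /(full_cycle_index Aj_lt n_gt0 A_full A_ret)[].
have posB_iter m : posB (iter m (B j) 0) = m %% n.
  rewrite (iter_modn _ (full_cycle_return n_gt0 B_full B_ret)).
  by rewrite /posB full_cycle_index_iter// ltn_pmod.
have valA m : val (iter m (tnth a j) origin) = iter m (A j) 0.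
  by rewrite (iter_perm j m origin A_val).
have valB m : val (iter m (tnth b j) origin) = iter m (B j) 0.
  by rewrite (iter_perm j m origin B_val).
have Av (k : 'I_d) (z : 'I_n) : val (tnth a k z) = A k (val z) by rewrite A_val.
have Bv (k : 'I_d) (z : 'I_n) : val (tnth b k z) = B k (val z) by rewrite B_val.
split=> [[r ltr eq]|[tau conj]].
(* The only candidate for a shift [r]: the point at position [i] on the cycle of [a_j] goes to
   position [i + r] on that of [b_j]. *)
- pose f (z : 'I_n) := iter (posA z + r) (tnth b j) origin.
  have f_inj : injective f.
    move=> z z' /(congr1 val); rewrite !valB => /(congr1 posB).
    rewrite !posB_iter => /eqP; rewrite eqn_modDr !modn_small ?posA_n// => /eqP eqz.
    by apply: val_inj; rewrite /= -(posAK z)// eqz posAK.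
  have comm (k : 'I_d) z : f (tnth a k z) = tnth b k (f z).
    apply: val_inj; rewrite valB Bv valB.
    rewrite -[RHS]posBK ?B_lt ?iter_lt// -/(posB _) /posB eq ?posA_n//.
    rewrite -(iter_modn _ (full_cycle_return n_gt0 B_full B_ret)).
    by rewrite posAK// Av.
  exists (perm f_inj) => k; apply/permP => x; rewrite !permM permE comm -(permE f_inj).
  by rewrite permKV.
- have comm (k : 'I_d) z : tau (tnth a k z) = tnth b k (tau z).
    by rewrite conj !permM permK.
  have tau0 : val (tau origin) = iter (posB (tau origin)) (B j) 0 by rewrite posBK.
  have tau_iter m : val (tau (iter m (tnth a j) origin)) =
      iter (m + posB (tau origin)) (B j) 0.
    elim: m => [|m IH]; first exact: tau0.
    transitivity (B j (val (tau (iter m (tnth a j) origin)))).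
      by rewrite -(Bv j) -comm.
    by rewrite IH.
  exists (posB (tau origin)) => [|k i ltk lti].
    by have [] := full_cycle_index Bj_lt n_gt0 B_full B_ret (ltn_ord (tau origin)).
  pose k' := Ordinal ltk; rewrite -tau_iter -(Bv k') -comm.
  have -> : A k (iter i (A j) 0) = val (tnth a k' (iter i (tnth a j) origin)).
    by rewrite -valA -(Av k').
  set z := tnth a k' _; rewrite -/(posB _) -/(posA _).
  have zE : z = iter (posA z) (tnth a j) origin.
    by apply: val_inj; rewrite valA posAK.
  by rewrite {1}zE tau_iter posB_iter.
Qed.

End Perms.

End Conjugacy.

Theorem theorem3 :
  forall c : nat, exists (P : program) (C : nat),
  forall (w n d : nat), 0 < w -> n <= c * 2 ^ w -> d <= c * 2 ^ w ->
  forall (a b : d.-tuple 'S_n),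
  (exists j : 'I_d, is_ncycle (tnth a j) /\ is_ncycle (tnth b j)) ->
  exists v : bool,
    halts_within w P (init_state w (nwords c) a b) v
      (C * (d * n)) (C * (d * n)) /\
    (v <-> exists tau : 'S_n,
             forall k : 'I_d, tnth b k = (tau^-1 * tnth a k * tau)%g).
Proof.
(* An input integer fits in [L] words. The space [9 * L * (d * n)] is at most [X * (2 ^ w) ^ 2], and
   [X < 2 ^ X], so [X + 2] words hold every address; the summand [L] in [K] secures [L <= K]. *)
move=> c; pose L := nwords c; pose X := 9 * L * c ^ 2; pose K := X + 2 + L.
exists (test_program K L conj_test vt vN).
(* The summands pay for [conj_test], for the final comparison with its [Halt], and for the space. *)
exists (unit_cost K L * 300 + (6 + 16 * K) + 9 * L).
move=> w n d w_gt0 le_n le_d a b [j [cyc_a cyc_b]].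
(* The promised index and a point of its cycle make [d] and [n] positive, so additive constants are
   absorbed by [d * n]. *)
have d_gt0 : 0 < d by case: (d) j {cyc_a cyc_b} => // -[].
have n_gt0 : 0 < n by have [[i lti] _] := cyc_a; apply: leq_ltn_trans lti.
pose inp := nth 0 (input_ints a b); pose S := 9 * L * (d * n).
pose A k z := inp (2 + (k * n + z)); pose B k z := inp (2 + d * n + (k * n + z)).
have A_val (k : 'I_d) (z : 'I_n) : A k z = tnth a k z by apply: input_ints_fst.
have B_val (k : 'I_d) (z : 'I_n) : B k z = tnth b k z by apply: input_ints_snd.
have A_lt := perm_values_lt A_val; have B_lt := perm_values_lt B_val.
have A_ret := perm_return n_gt0 A_val; have B_ret := perm_return n_gt0 B_val.
have A_full := ncycle_full n_gt0 A_val cyc_a.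
have B_full := ncycle_full n_gt0 B_val cyc_b.
have le_dn : d * n <= c ^ 2 * (2 ^ w) ^ 2.
  by rewrite -expnMn -mulnn leq_mul.
have lt_word x : x <= c * 2 ^ w -> x < 2 ^ (w * L).
  move=> /leq_ltn_trans; apply.
  rewrite /L /nwords mulnS expnD mulnC ltn_pmul2l ?expn_gt0//.
  by apply: leq_trans (ltn_expl c (isT : 1 < 2)) _; rewrite leq_exp2l// leq_pmull.
have S_lt : S < 2 ^ (w * K).
  apply: (@leq_ltn_trans (X * (2 ^ w) ^ 2)).
    by rewrite /S /X -[9 * L * c ^ 2 * _]mulnA leq_mul2l le_dn orbT.
  apply: (@leq_trans (2 ^ (w * (X + 2)))); last first.
    by rewrite leq_exp2l// leq_mul2l leq_addr orbT.
  rewrite mulnDr expnD -expnM ltn_pmul2r ?expn_gt0//.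
  by apply: leq_trans (ltn_expl X (isT : 1 < 2)) _; rewrite leq_exp2l// leq_pmull.
have le_LK : L <= K by apply: leq_addl.
(* Origin of the factor 9: as [1] and [n] are at most [d * n], the number of cells is at most
   [(2 + 4 + 3) * (d * n)]. *)
have mem_le : L * (2 + 4 * (d * n) + 3 * n) <= S.
  rewrite /S mulnAC mulnC leq_mul2r /L /=.
  have : n <= d * n by apply: leq_pmull.
  have : 0 < d * n by rewrite muln_gt0 d_gt0.
  lia.
have test := @wp_conj_test w S K L w_gt0 S_lt le_LK n d A B inp n_gt0 d_gt0
  (ltn0Sn c) (lt_word _ le_n) mem_le erefl erefl (fun _ _ _ _ => erefl)
  (fun _ _ _ _ => erefl) A_lt B_lt A_ret
  (ex_intro2 _ _ (val j) (ltn_ord j) (conj A_full B_full)) B_ret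
  (VState (fun=> 0) inp) erefl (fun=> erefl).
have init_rep : rep w K L (VState (fun=> 0) inp) (fun=> 0)
    (nth 0 (input_words w L a b)).
  split=> // [r|r|x|p].
  - by rewrite expn_gt0.
  - exact: words_word.
  - by rewrite /mval address0.
  - apply: address_words_nth => //; apply/allP => x.
    by apply: input_ints_lt; apply: lt_word.
have [s [es [k ltk [kA kB sP]]] halts] :=
  wp_halts_within w_gt0 S_lt le_LK vt vN test init_rep.
exists (vars s vN <= vars s vt); split.
  have dn_gt0 : 0 < d * n by rewrite muln_gt0 d_gt0.
  apply: halts_within_weaken halts.
    rewrite mulnA -addnA mulnDl leq_add2l mulnDl.
    by apply: leq_trans (leq_addr _ _); rewrite leq_pmulr.
  by rewrite /S mulnDl leq_addl.
rewrite (env_vars es); apply: iff_trans sP _.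
exact: (conjugate_iff n_gt0 A_val B_val (j := Ordinal ltk)).
Qed.
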